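(* Let $C$ be a smooth curve of genus $g$ and $P\in C$ a point with first (smallest positive) non-gap $a$, such that the first non-gap $b$ of $P$ that is not a multiple of $a$ satisfies $b=na+r$ with $n\geq 1$, $0<r<a$; assume $\gcd(a,b)=1$. Assume $g=(a-1)(b-1)/2$ and let $Q\in C$ with $Q\neq P$ and $aQ\in|aP|$. For an integer $t\geq 1$, let $s$ be the number of non-gaps $e$ of $P$ satisfying $ta<e<(t+1)a$. Then the non-gaps $e$ of $Q$ satisfying $ta<e<(t+1)a$ are exactly the integers $(t+1)a-i$ with $1\leq i\leq s$.
   Context: Curves are smooth, irreducible, projective, over $\mathbb{C}$. For a point $P\in C$, $\mathrm{WS}(P)=\{0\}\cup\{m\in\mathbb{N}: |mP| \text{ is base point free}\}$, and its elements are the non-gaps of $P$. $|D|$ denotes the complete linear system of $D$. *)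

(* Defs.v *)
From HB Require Import structures.
From mathcomp Require Import all_boot all_order all_algebra.
From mathcomp Require Import boolp classical_sets.
From mathcomp Require Import freeg mpoly.

Set Implicit Arguments.
Unset Strict Implicit.
Unset Printing Implicit Defensive.
Import Order.TTheory GRing.Theory Num.Theory.
Local Open Scope classical_set_scope.
Local Open Scope quotient_scope.
Local Open Scope ring_scope.

Section ProjectiveSpace.
Variables (k : closedFieldType) (N : nat).

(* P^N(k): the lines through the origin of k^(N+1). *)
Definition proj_point := {L : {vspace 'rV[k]_N.+1} | \dim L == 1%N}.

Definition point_vec (p : proj_point) : 'rV[k]_N.+1 := vpick (val p).

(* For homogeneous F this is the usual F(p) = 0; for arbitrary F it says that
   F vanishes on the whole line p, i.e. that each homogeneous component does. *)
Definition vanishes_at (F : {mpoly k[N.+1]}) (p : proj_point) : Prop :=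
  forall v, v \in val p -> F.@[v 0] = 0.

Definition zariski_closed (X : set proj_point) : Prop :=
  exists S : set {mpoly k[N.+1]},
    (forall F, S F -> exists d, F \is d.-homog) /\
    X = [set p | forall F, S F -> vanishes_at F p].

Definition irreducible_set (X : set proj_point) : Prop :=
  X !=set0 /\
  forall Y Z, zariski_closed Y -> zariski_closed Z ->
    X `<=` Y `|` Z -> X `<=` Y \/ X `<=` Z.

Record proj_variety := ProjVariety {
  variety_set :> set proj_point;
  _ : zariski_closed variety_set;
  variety_irreducible : irreducible_set variety_set }.

(* The homogeneous ideal I(X). *)
Definition variety_ideal (X : proj_variety) : {pred {mpoly k[N.+1]}} :=
  fun F => `[< X `<=` [set p | vanishes_at F p] >].

Section Ray.
Variable v : 'rV[k]_N.+1.

(* The restriction of F to the line spanned by v. *)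
Definition ray (F : {mpoly k[N.+1]}) : {poly k} :=
  mmap (@polyC k) (fun i => v 0 i *: 'X) F.

Lemma rayM F G : ray (F * G) = ray F * ray G.
Proof. by rewrite /ray rmorphM. Qed.

Lemma horner_ray F c : (ray F).[c] = F.@[(c *: v) 0].
Proof.
rewrite mevalE /ray /mmap horner_sum; apply: eq_bigr => m _.
rewrite hornerM hornerC /mmap1 horner_prod; congr (_ * _).
by apply: eq_bigr => i _; rewrite horner_exp hornerZ hornerX mxE mulrC.
Qed.

Lemma coef_ray F d : (ray F)`_d = (pihomog mdeg d F).@[v 0].
Proof.
rewrite pihomogE raddf_sum /= /ray /mmap coef_sum [RHS]big_mkcond /=.
apply: eq_bigr => m _.
have -> : mmap1 (fun i => v 0 i *: 'X) m
        = (mmap1 (v 0) m)%:P * 'X^(mdeg m).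
  rewrite /mmap1 rmorph_prod mdegE -prodrXr -big_split /=.
  by apply: eq_bigr => i _; rewrite exprZn mul_polyC.
rewrite mulrA -polyCM coefCM coefXn eq_sym.
case: eqP => _; last by rewrite mulr0.
by rewrite mulr1 mevalZ mevalX.
Qed.

End Ray.

Lemma mem_point (p : proj_point) v :
  v \in val p -> exists c, v = c *: point_vec p.
Proof.
case: p => L dL /= vL; rewrite /point_vec /=; apply/vlineP.
suff -> : <[vpick L]>%VS = L by [].
apply/eqP; rewrite eqEdim (eqP dL) dim_vline vpick0 -dimv_eq0 (eqP dL) /= andbT.
by rewrite -memvE memv_pick.
Qed.

Lemma point_memZ (p : proj_point) c : c *: point_vec p \in val p.
Proof. by apply/memvZ/memv_pick. Qed.

Lemma poly_eq0 (q : {poly k}) : (forall c, q.[c] = 0) -> q = 0.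
Proof.
move=> q0; apply/eqP/negPn/negP => /closed_nonrootP [c].
by rewrite rootE q0 eqxx.
Qed.

Lemma vanishes_rayP F (p : proj_point) :
  vanishes_at F p <-> ray (point_vec p) F = 0.
Proof.
split=> [F0|r0 v /mem_point [c ->]]; last by rewrite -horner_ray r0 horner0.
by apply: poly_eq0 => c; rewrite horner_ray F0 ?point_memZ.
Qed.

Lemma vanishing_closed F : zariski_closed [set p | vanishes_at F p].
Proof.
exists [set G | exists d, G = pihomog mdeg d F]; split=> [G [d ->]|].
  by exists d; apply: pihomogP.
apply/seteqP; split=> p /=.
  move=> /vanishes_rayP r0 G [d ->]; apply/vanishes_rayP/polyP => e.
  rewrite coef_ray coef0; have [<-|ne] := eqVneq d e.
    by rewrite pihomog_id -coef_ray r0 coef0.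
  by rewrite (pihomog_ne0 (d := d)) ?meval0 ?pihomogP.
move=> r0; apply/vanishes_rayP/polyP => d; rewrite coef_ray coef0.
by apply: (r0 _ (ex_intro _ d erefl)); rewrite memv_pick.
Qed.

Lemma variety_ideal_closed (X : proj_variety) :
  idealr_closed (variety_ideal X).
Proof.
split=> [||a F G /asboolP F0 /asboolP G0].
- by apply/asboolP => p Xp v vp; rewrite meval0.
- apply/negP => /asboolP one0; have [[p Xp] _] := variety_irreducible X.
  have /eqP := one0 p Xp _ (memv_pick _).
  by rewrite meval1 oner_eq0.
- apply/asboolP => p Xp v vp.
  by rewrite mevalD mevalM (F0 p) // (G0 p) // mulr0 addr0.
Qed.

Lemma variety_ideal_prime (X : proj_variety) :
  prime_idealr_closed (variety_ideal X).
Proof.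
move=> F G /asboolP FG0; have [_ irrX] := variety_irreducible X.
have [|FX|GX] := irrX _ _ (vanishing_closed F) (vanishing_closed G).
- move=> p Xp; have /vanishes_rayP := FG0 p Xp.
  rewrite rayM => /eqP; rewrite mulf_eq0 => /orP [] /eqP r0.
  + by left; apply/vanishes_rayP.
  + by right; apply/vanishes_rayP.
- by apply/orP; left; apply/asboolP => p /FX.
- by apply/orP; right; apply/asboolP => p /GX.
Qed.

HB.instance Definition _ (X : proj_variety) :=
  isIdealr.Build _ (variety_ideal X) (variety_ideal_closed X).
HB.instance Definition _ (X : proj_variety) :=
  isPrimeIdealrClosed.Build _ (variety_ideal X) (@variety_ideal_prime X).

(* The homogeneous coordinate ring S(X) = k[x_0, ..., x_N] / I(X). *)
Definition coord_ring (X : proj_variety) := {ideal_quot (variety_ideal X)}.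

Section CoordRing.
Variable X : proj_variety.
Local Notation S := (coord_ring X).

HB.instance Definition _ := GRing.ComNzRing.on S.

Definition coord_unit : {pred S} := fun x => `[< exists y, y * x = 1 >].
Definition coord_inv (x : S) : S :=
  if pselect (exists y, y * x = 1) is left e then projT1 (cid e) else x.

Fact coord_mulVr : {in coord_unit, left_inverse 1 coord_inv *%R}.
Proof.
move=> x /asboolP ux; rewrite /coord_inv.
by case: pselect => // e; case: (cid e).
Qed.

Fact coord_unitP (x y : S) : y * x = 1 -> coord_unit x.
Proof. by move=> yx1; apply/asboolP; exists y. Qed.

Fact coord_invr_out : {in [predC coord_unit], coord_inv =1 id}.
Proof.
move=> x /asboolP nux; rewrite /coord_inv.
by case: pselect => // e; case: nux.
Qed.

HB.instance Definition _ := GRing.ComNzRing_hasMulInverse.Build S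
  coord_mulVr coord_unitP coord_invr_out.
HB.instance Definition _ := GRing.ComUnitRing_isIntegral.Build S
  (@Quotient.rquot_IdomainAxiom _ (variety_ideal X)).

Definition hfrac := {fraction S}.

Definition hclass (F : {mpoly k[N.+1]}) : hfrac :=
  @FracField.tofrac S (\pi_S F).

(* k(X): the degree-zero elements F / G of Frac S(X). *)
Definition function_field : set hfrac :=
  [set f | exists d F G, [/\ F \is d.-homog, G \is d.-homog,
     hclass G != 0 & f = hclass F / hclass G]].

Definition local_ring (p : proj_point) : set hfrac :=
  [set f | exists d F G, [/\ F \is d.-homog, G \is d.-homog,
     ~ vanishes_at G p & f = hclass F / hclass G]].

Definition max_ideal (p : proj_point) : set hfrac :=
  [set f | exists d F G, [/\ F \is d.-homog, G \is d.-homog,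
     ~ vanishes_at G p, vanishes_at F p & f = hclass F / hclass G]].

Definition scalar (c : k) : hfrac := hclass c%:MP.

Definition transcendental (x : hfrac) : Prop :=
  forall q : {poly k}, q != 0 -> ~~ root (map_poly scalar q) x.

(* For x transcendental: y is algebraic over k(x). Clearing denominators, an
   equation for y may be taken with coefficients in k[x]. *)
Definition algebraic_over_adjoin (x y : hfrac) : Prop :=
  exists2 q : {poly {poly k}}, q != 0 &
    root (map_poly (fun c : {poly k} => (map_poly scalar c).[x]) q) y.

(* dim X = 1, the dimension of a variety being the transcendence degree of its
   function field. *)
Definition dimension_one : Prop :=
  exists x, [/\ function_field x, transcendental x &
    forall y, function_field y -> algebraic_over_adjoin x y].

(* Jacobian criterion for a point of a one-dimensional variety in P^N: among
   the gradients at p of the elements of I(X), N - 1 are independent. *)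
Definition smooth_at (p : proj_point) : Prop :=
  exists F : 'I_N.-1 -> {mpoly k[N.+1]},
    (forall i, F i \in variety_ideal X) /\
    \rank (\matrix_(i < N.-1, j < N.+1) (mderiv j (F i)).@[point_vec p 0])
      = N.-1.

End CoordRing.

Record smooth_curve := SmoothCurve {
  curve_variety :> proj_variety;
  _ : dimension_one curve_variety;
  _ : forall p, variety_set curve_variety p -> smooth_at curve_variety p }.

End ProjectiveSpace.

Section Curve.
Variables (k : closedFieldType) (N : nat) (C : smooth_curve k N).
Local Notation K := (hfrac C).

Definition uniformizer (P : C) (t : K) : Prop :=
  max_ideal (val P) t /\
  forall h, max_ideal (val P) h ->
    exists2 q, local_ring (val P) q & h = t * q.

(* ord_P(f) = z, i.e. f = u t^z with u a unit of the discrete valuation ring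
   O_P and t a uniformizer; no z qualifies when f = 0. *)
Definition has_ord (P : C) (f : K) (z : int) : Prop :=
  exists t u, [/\ uniformizer P t, local_ring (val P) u,
    ~ max_ideal (val P) u & f = u * t ^ z].

Definition lin_equiv (D E : {freeg C}) : Prop :=
  exists f, [/\ function_field f, f != 0 &
    forall P : C, has_ord P f (coeff P D - coeff P E)].

(* |D| *)
Definition linear_system (D : {freeg C}) : set {freeg C} :=
  [set E | fgle 0 E /\ lin_equiv E D].

Definition base_point_free (D : {freeg C}) : Prop :=
  forall P : C, exists2 E, linear_system D E & coeff P E = 0.

(* WS(P) *)
Definition nongaps (P : C) : set nat :=
  [set m | m = 0%N \/ base_point_free (<< P >> *+ m)].

(* L(D) = {f in k(C) | f = 0 or div f + D >= 0} *)
Definition rr_space (D : {freeg C}) : set K :=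
  [set f | function_field f /\
    (f = 0 \/ forall P : C, exists2 z, has_ord P f z & - coeff P D <= z)].

Definition kdim (V : set K) (m : nat) : Prop :=
  exists e : 'I_m -> K,
    (forall c : 'I_m -> k,
       \sum_i scalar C (c i) * e i = 0 -> forall i, c i = 0) /\
    V = [set \sum_i scalar C (c i) * e i | c in [set: 'I_m -> k]].

(* Riemann's theorem taken as the definition of the genus:
   g = max over divisors D of deg D + 1 - l(D). *)
Definition genus (g : nat) : Prop :=
  (forall D m, kdim (rr_space D) m -> deg D + 1 - m%:Z <= g%:Z) /\
  (exists D m, kdim (rr_space D) m /\ deg D + 1 - m%:Z = g%:Z).

End Curve.

(* Main.v *)
(* Multiplication by powers and the Riemann inequality (the definition of the
   genus) give what is needed of Riemann-Roch: principal divisors have degree 0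
   and l(D + mP) = deg D + m + 1 - g for m large. Choose x with divisor aQ - aP
   and y with a pole of order b at P only and with y(Q) = 0. The semigroup
   generated by a and b has exactly g = (a - 1)(b - 1)/2 gaps, so the monomials
   x^i y^j with j < a form a basis of the functions regular outside P.
   Some such function has a simple zero at Q, whereas x vanishes there to order
   a >= 2; hence y has a simple zero at Q. Multiplying by x^(t + 1) turns
   functions with their only pole at Q, of order (t + 1)a - i, into functions in
   L((t + 1)aP) vanishing to order i at Q. Modulo order a at Q the latter are
   polynomials in y of degree j with jb <= (t + 1)a, so all i with
   ib < (t + 1)a occur and no others; the non-gaps of P between ta and
   (t + 1)a represent the classes of jb modulo a for the same values of j. *)
Require Import Defs.
From HB Require Import structures.
From mathcomp Require Import all_boot all_order all_algebra.
From mathcomp Require Import boolp classical_sets reals.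
From mathcomp Require Import ring zify.
From mathcomp Require Import freeg mpoly complex.
Import Order.TTheory GRing.Theory Num.Theory.
Local Open Scope classical_set_scope.
Local Open Scope ring_scope.

Set Implicit Arguments.
Unset Strict Implicit.
Unset Printing Implicit Defensive.

(** * Algebraic dependence over k(t) *)

Section AdjoinField.
Variables (k K : fieldType) (sc : {rmorphism k -> K}) (t : K).

(** The subfield k(t) of K. A vanishing denominator is allowed: the fraction is then 0 by
    convention, which still lies in k(t). *)
Definition adjoin_pred : {pred K} :=
  fun y => `[< exists p q : {poly k},
                 y = (map_poly sc p).[t] / (map_poly sc q).[t] >].

Lemma adjoin_divring_closed : divring_closed adjoin_pred.
Proof.
split=> [|_ _ /asboolP [p [q ->]] /asboolP [p' [q' ->]]
         |_ _ /asboolP [p [q ->]] /asboolP [p' [q' ->]]]; apply/asboolP.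
- by exists 1, 1; rewrite rmorph1 hornerC invr1 mulr1.
- have [q0|q0] := eqVneq (map_poly sc q).[t] 0.
    exists (- p'), q'; rewrite q0 invr0 mulr0 add0r rmorphN hornerN mulNr //.
  have [q0'|q0'] := eqVneq (map_poly sc q').[t] 0.
    by exists p, q; rewrite q0' invr0 mulr0 subr0.
  exists (p * q' - p' * q), (q * q').
  rewrite rmorphB !rmorphM hornerD hornerN !hornerM; field;
  by rewrite q0 q0'.
- exists (p * q'), (q * p'); rewrite !rmorphM !hornerM !invfM invrK.
  by rewrite [RHS]mulrACA [X in _ = _ * X]mulrC.
Qed.

HB.instance Definition _ :=
  GRing.isDivringClosed.Build K adjoin_pred adjoin_divring_closed.

Record adjoin_type :=
  Adjoin { adjoin_val : K; _ : adjoin_val \in adjoin_pred }.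
HB.instance Definition _ := [isSub for adjoin_val].
HB.instance Definition _ := [Choice of adjoin_type by <:].
HB.instance Definition _ := [SubChoice_isSubComUnitRing of adjoin_type by <:].
HB.instance Definition _ := [SubComUnitRing_isSubIntegralDomain of adjoin_type by <:].
HB.instance Definition _ := [SubIntegralDomain_isSubField of adjoin_type by <:].

Definition adjoin_inj : {rmorphism adjoin_type -> K} := \val.

Lemma adjoin_scP c : sc c \in adjoin_pred.
Proof.
by apply/asboolP; exists c%:P, 1; rewrite map_polyC rmorph1 !hornerC divr1.
Qed.

Lemma adjoin_horner p : (map_poly sc p).[t] \in adjoin_pred.
Proof. by apply/asboolP; exists p, 1; rewrite rmorph1 hornerC divr1. Qed.

Lemma integral_adjoinP (p : {poly K}) y : p != 0 -> root p y ->
  (forall i, p`_i \in adjoin_pred) -> integralOver adjoin_inj y.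
Proof.
move=> p0 py pS; apply: (integral_root p0 py); apply/integral_poly => i.
by have := integral_id adjoin_inj (Adjoin (pS i)).
Qed.

Hypothesis t_transc : forall q : {poly k}, q != 0 -> ~~ root (map_poly sc q) t.
Variable x : K.
Hypothesis x_transc : forall q : {poly k}, q != 0 -> ~~ root (map_poly sc q) x.

Let alg_over (x y : K) := exists2 q : {poly {poly k}}, q != 0 &
    root (map_poly (fun c : {poly k} => (map_poly sc c).[x]) q) y.

Lemma map_transc_neq0 z (q : {poly {poly k}}) :
  (forall q : {poly k}, q != 0 -> ~~ root (map_poly sc q) z) ->
  q != 0 -> map_poly (fun c : {poly k} => (map_poly sc c).[z]) q != 0.
Proof.
move=> tr; apply: contraNneq => q0.
apply/eqP/polyP => i; rewrite coef0; apply/eqP; apply/negPn/negP => /tr.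
rewrite rootE => /negP; apply.
move/polyP/(_ i): q0; rewrite coef_map_id0 ?coef0 => [->//|].
by rewrite rmorph0 horner0.
Qed.

(** A relation q(x, t) = 0 is also an equation for x with coefficients in k[t]: exchanging the two
    variables gives it, and it stays nonzero because t is transcendental. *)
Lemma alg_over_sym : alg_over x t -> integralOver adjoin_inj x.
Proof.
move=> [q q0 qt].
pose ev c := (map_poly sc c).[t].
have [p pE] : exists p, p = map_poly ev (swapXY q) by eexists.
apply: (@integral_adjoinP p).
- by rewrite pE map_transc_neq0 // swapXY_eq0.
- have ev0 : ev 0 = 0 by rewrite /ev rmorph0 horner0.
  move/rootP: qt => qt; apply/rootP; rewrite -qt pE.
  rewrite (@horner_coef_wide _ (sizeY q)); last first.
    by rewrite sizeYE; apply: size_poly.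
  rewrite (@horner_coef_wide _ (size q)); last by apply: size_poly.
  under eq_bigr => i _.
    rewrite coef_map_id0 // /ev.
    rewrite (@horner_coef_wide _ (size q)); last first.
      rewrite size_map_poly; apply/leq_sizeP => j jq.
      by rewrite coef_swapXY (nth_default _ jq) coef0.
    rewrite mulr_suml; under eq_bigr do rewrite coef_map /= coef_swapXY.
  over.
  under [RHS]eq_bigr => j _.
    rewrite coef_map_id0 ?rmorph0 ?horner0 //.
    rewrite (@horner_coef_wide _ (sizeY q)); last first.
      by rewrite size_map_poly; apply: max_size_coefXY.
    rewrite mulr_suml; under eq_bigr do rewrite coef_map /=.
  over.
  rewrite exchange_big /=; apply: eq_bigr => j _; apply: eq_bigr => i _.
  by rewrite mulrAC.
- move=> i; rewrite pE coef_map_id0 ?adjoin_horner //.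
  by rewrite /ev rmorph0 horner0.
Qed.

(* Steinitz exchange in transcendence degree one. *)
Lemma alg_over_exchange y : alg_over x t -> alg_over x y ->
  exists q : {poly K},
    [/\ q != 0, root q y & forall i, q`_i \in adjoin_pred].
Proof.
move=> /alg_over_sym xint [q q0 qy].
have : integralOver adjoin_inj y.
  apply: (integral_root (map_transc_neq0 x_transc q0) qy).
  apply/integral_poly => i; rewrite coef_map_id0 ?rmorph0 ?horner0 //.
  apply: integral_horner => //; apply/integral_poly => j.
  rewrite coef_map.
  by have := integral_id adjoin_inj (Adjoin (adjoin_scP q`_i`_j)).
move=> [p pmon py]; exists (map_poly adjoin_inj p).
split=> //; first by rewrite map_poly_eq0 monic_neq0.
by move=> i; rewrite coef_map; case: (p`_i).
Qed.

End AdjoinField.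

(** * Fractions of homogeneous polynomials *)

Section HomogeneousFractions.
Variables (k : closedFieldType) (N : nat) (K : fieldType).
Variable cls : {rmorphism {mpoly k[N.+1]} -> K}.
Implicit Types f g h : K.

Definition hom_field f := exists d F G,
  [/\ F \is d.-homog, G \is d.-homog, cls G != 0 & f = cls F / cls G].

Definition hom_scalar (c : k) : K := cls c%:MP.

Lemma hom_scalar_is_zmod_morphism : zmod_morphism hom_scalar.
Proof. by move=> c d; rewrite /hom_scalar mpolyCB rmorphB. Qed.
Lemma hom_scalar_is_monoid_morphism : monoid_morphism hom_scalar.
Proof. by split=> [|c d]; rewrite /hom_scalar ?rmorph1 // mpolyCM rmorphM. Qed.
HB.instance Definition _ :=
  GRing.isZmodMorphism.Build k K hom_scalar hom_scalar_is_zmod_morphism.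
HB.instance Definition _ :=
  GRing.isMonoidMorphism.Build k K hom_scalar hom_scalar_is_monoid_morphism.

Lemma dhomogC (c : k) : (c%:MP : {mpoly k[N.+1]}) \is 0.-homog.
Proof. by rewrite -[c%:MP]mulr1 mul_mpolyC; apply/dhomogZ/dhomog1. Qed.

Lemma hom_fieldV f : hom_field f -> hom_field f^-1.
Proof.
move=> [d [F [G [hF hG nG ->]]]]; rewrite invfM invrK mulrC.
have [F0|F0] := eqVneq (cls F) 0; last by exists d, G, F.
exists 0%N, 0, 1; rewrite dhomog0 dhomog1 rmorph1 oner_eq0.
by rewrite F0 invr0 mulr0 rmorph0 mul0r; split.
Qed.

Lemma hom_fieldM f g : hom_field f -> hom_field g -> hom_field (f * g).
Proof.
move=> [d [F [G [hF hG nG ->]]]] [e [F' [G' [hF' hG' nG' ->]]]].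
exists (d + e)%N, (F * F'), (G * G'); rewrite !dhomogM // !rmorphM mulf_neq0 //.
by rewrite mulf_div; split.
Qed.

Lemma hom_fieldD f g : hom_field f -> hom_field g -> hom_field (f + g).
Proof.
move=> [d [F [G [hF hG nG ->]]]] [e [F' [G' [hF' hG' nG' ->]]]].
exists (d + e)%N, (F * G' + F' * G), (G * G').
rewrite dhomogM // rmorphD !rmorphM mulf_neq0 // addf_div //; split=> //.
by apply: dhomogD; [exact: dhomogM | rewrite addnC; exact: dhomogM].
Qed.

Lemma hom_field_scalar c : hom_field (hom_scalar c).
Proof.
exists 0%N, c%:MP, 1.
by rewrite rmorph1 oner_eq0 divr1 dhomog1 dhomogC; split.
Qed.

Section AtPoint.
Variables (p : proj_point k N).
Local Notation ev F := (F.@[point_vec p 0]).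
Hypothesis cls_ev : forall F, cls F = 0 -> ev F = 0.

(** With [cls] the class map into Frac S(X), these are the local ring at p and its maximal ideal.
    Vanishing on the line p is replaced by vanishing at one spanning vector, which is the same for
    homogeneous forms. *)
Definition hom_local f := exists d F G,
  [/\ F \is d.-homog, G \is d.-homog, ev G != 0 & f = cls F / cls G].
Definition hom_max f := exists d F G,
  [/\ F \is d.-homog, G \is d.-homog, ev G != 0, ev F = 0 & f = cls F / cls G].

Lemma ev_cls G : ev G != 0 -> cls G != 0.
Proof. by apply: contraNneq => /cls_ev ->. Qed.

Lemma hom_local_field f : hom_local f -> hom_field f.
Proof. by move=> [d [F [G [hF hG /ev_cls nG ->]]]]; exists d, F, G. Qed.

Lemma hom_max_local f : hom_max f -> hom_local f.
Proof. by move=> [d [F [G [? ? ? ? ->]]]]; exists d, F, G. Qed.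

Lemma hom_local_scalar c : hom_local (hom_scalar c).
Proof.
exists 0%N, c%:MP, 1.
by rewrite meval1 oner_eq0 rmorph1 divr1 dhomog1 dhomogC; split.
Qed.

Lemma hom_localM f g : hom_local f -> hom_local g -> hom_local (f * g).
Proof.
move=> [d [F [G [hF hG nG ->]]]] [e [F' [G' [hF' hG' nG' ->]]]].
exists (d + e)%N, (F * F'), (G * G'); rewrite !dhomogM // !rmorphM.
by rewrite mulf_neq0 // mulf_div; split.
Qed.

Lemma hom_localD f g : hom_local f -> hom_local g -> hom_local (f + g).
Proof.
move=> [d [F [G [hF hG nG ->]]]] [e [F' [G' [hF' hG' nG' ->]]]].
exists (d + e)%N, (F * G' + F' * G), (G * G').
rewrite dhomogM // !rmorphD !rmorphM mulf_neq0 // addf_div ?ev_cls //.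
split=> //.
by apply: dhomogD; [exact: dhomogM | rewrite addnC; exact: dhomogM].
Qed.

Lemma hom_maxM f g : hom_max f -> hom_local g -> hom_max (f * g).
Proof.
move=> [d [F [G [hF hG nG F0 ->]]]] [e [F' [G' [hF' hG' nG' ->]]]].
exists (d + e)%N, (F * F'), (G * G'); rewrite !dhomogM // !mevalM !rmorphM.
by rewrite mulf_neq0 // F0 mul0r mulf_div; split.
Qed.

(** If F / G = 1 then F - G has class 0, so F and G take the same value at p, although only F
    vanishes there. *)
Lemma hom_max1 : ~ hom_max 1.
Proof.
move=> [d [F [G [hF hG nG F0]]]].
move=> /(canLR (divfK (ev_cls nG))); rewrite mul1r => /eqP.
rewrite -subr_eq0 -rmorphB => /eqP/cls_ev.
by rewrite mevalB F0 subr0 => /eqP; apply/negP.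
Qed.

Lemma hom_local_unit f : hom_local f -> ~ hom_max f -> hom_local f^-1.
Proof.
move=> [d [F [G [hF hG nG fE]]]] nf.
exists d, G, F; split=> //; last by rewrite fE invfM invrK mulrC.
by apply/eqP => F0; apply: nf; exists d, F, G.
Qed.

(** The residue of F / G is the quotient of the two values at p, so the residue field is k. *)
Lemma hom_residue f : hom_local f -> exists c, hom_max (f - hom_scalar c).
Proof.
move=> [d [F [G [hF hG nG ->]]]]; exists (ev F / ev G).
exists d, (F - (ev F / ev G) *: G), G; split=> //.
- by rewrite dhomogD // dhomogN dhomogZ.
- by rewrite mevalB mevalZ divfK ?subrr.
- by rewrite -mul_mpolyC rmorphB [cls (_ * G)]rmorphM mulrBl mulfK // ev_cls.
Qed.

(* A linear form not vanishing at [p] dehomogenizes numerator and denominator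
   separately. *)
Lemma hom_field_local f : hom_field f ->
  exists g h, [/\ hom_local g, hom_local h, h != 0 & f = g / h].
Proof.
move=> [d [F [G [hF hG nG ->]]]].
have [i vi] : exists i, point_vec p 0 i != 0.
  apply/rV0Pn; rewrite /point_vec vpick0 -dimv_eq0; case: (p) => L /= /eqP ->.
  by [].
have hL : ('X_i ^+ d : {mpoly k[N.+1]}) \is d.-homog.
  rewrite -[d in d.-homog]mul1n; apply: dhomogMn.
  by rewrite dhomogX /= mdeg1.
have nL : ev ('X_i ^+ d) != 0 by rewrite rmorphXn /= mevalXU expf_neq0.
exists (cls F / cls ('X_i ^+ d)), (cls G / cls ('X_i ^+ d)).
have L0 := ev_cls nL.
split.
- by exists d, F, ('X_i ^+ d).
- by exists d, G, ('X_i ^+ d).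
- by rewrite mulf_neq0 // invr_eq0.
- by field; rewrite nG L0.
Qed.

End AtPoint.
End HomogeneousFractions.

(** * Discrete valuations *)

Section LocalRingWithResidueField.
Variables (k K : fieldType) (sc : {rmorphism k -> K}) (K0 O M : K -> Prop).

(** [O] is a local ring with maximal ideal [M], residue field k and field of fractions [K0].
    Discreteness of the valuation is not an axiom: it is derived below from a principal maximal
    ideal and transcendence degree one. *)
Record residue_local_ring : Prop := ResidueLocalRing {
  rlr_sc : forall c, O (sc c);
  rlrM : forall f g, O f -> O g -> O (f * g);
  rlrD : forall f g, O f -> O g -> O (f + g);
  rlr_max : forall f, M f -> O f;
  rlr_maxM : forall f g, M f -> O g -> M (f * g);
  rlr_max1 : ~ M 1;
  rlr_unit : forall f, O f -> ~ M f -> O f^-1;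
  rlr_residue : forall f, O f -> exists c, M (f - sc c);
  rlr_frac : forall f, K0 f -> exists g h, [/\ O g, O h, h != 0 & f = g / h];
  rlr_sub : forall f, O f -> K0 f }.

Hypothesis OM : residue_local_ring.

Definition principal_gen t := M t /\ forall h, M h -> exists2 q, O q & h = t * q.

Lemma rlr1 : O 1.
Proof. by rewrite -(rmorph1 sc); apply: rlr_sc. Qed.
Lemma rlr0 : O 0.
Proof. by rewrite -(rmorph0 sc); apply: rlr_sc. Qed.

Lemma unit_notmax f g : O g -> f * g = 1 -> ~ M f.
Proof. by move=> Og fg1 /(rlr_maxM OM)/(_ Og); rewrite fg1; apply: rlr_max1. Qed.

Lemma max0 : M 0.
Proof.
have [c] := rlr_residue OM rlr0; rewrite sub0r -rmorphN => Mc.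
have [c0|c0] := eqVneq (sc (- c)) 0; first by rewrite -c0.
case: (@rlr_max1 OM); rewrite -(divff c0); apply: (rlr_maxM OM) => //.
by rewrite -fmorphV; apply: rlr_sc.
Qed.

Lemma notmax_neq0 f : ~ M f -> f != 0.
Proof. by move=> nf; apply/eqP => f0; apply: nf; rewrite f0; apply: max0. Qed.

Lemma notmaxM f g : O f -> ~ M f -> O g -> ~ M g -> ~ M (f * g).
Proof.
move=> Of nf Og ng; apply: (@unit_notmax _ (f^-1 * g^-1)).
  by apply: (rlrM OM); apply: (rlr_unit OM).
by field; rewrite !notmax_neq0.
Qed.

Definition lunit f := O f /\ ~ M f.

Lemma lunitV f : lunit f -> lunit f^-1.
Proof.
move=> [Of nf]; split; first exact: (rlr_unit OM).
by apply: (@unit_notmax _ f) => //; rewrite mulVf ?notmax_neq0.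
Qed.

Lemma lunitM f g : lunit f -> lunit g -> lunit (f * g).
Proof. by move=> [Of nf] [Og ng]; split; [apply: (rlrM OM)|apply: notmaxM]. Qed.

Lemma lunit1 : lunit 1.
Proof. by split; [apply: rlr1|apply: rlr_max1]. Qed.

Lemma lunit_sc c : c != 0 -> lunit (sc c).
Proof.
move=> c0; split; first exact: rlr_sc.
apply: (@unit_notmax _ (sc c^-1)); first exact: rlr_sc.
by rewrite -rmorphM mulfV ?rmorph1.
Qed.

Lemma lunitX f (n : nat) : lunit f -> lunit (f ^+ n).
Proof.
move=> uf; elim: n => [|n IHn]; first exact: lunit1.
by rewrite exprS; apply: lunitM.
Qed.

Lemma lunitXz f (z : int) : lunit f -> lunit (f ^ z).
Proof. by move=> uf; case: z => n; [|apply: lunitV]; apply: lunitX. Qed.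

Lemma rlrX f (n : nat) : O f -> O (f ^+ n).
Proof.
move=> uf; elim: n => [|n IHn]; first exact: rlr1.
by rewrite exprS; apply: (rlrM OM).
Qed.

Variable x : K.
Hypothesis x_transc : forall q : {poly k}, q != 0 -> ~~ root (map_poly sc q) x.
Hypothesis K0x : K0 x.
Hypothesis K0_alg : forall y, K0 y -> exists2 q : {poly {poly k}}, q != 0 &
    root (map_poly (fun c : {poly k} => (map_poly sc c).[x]) q) y.

Variable t : K.
Hypothesis t_gen : principal_gen t.

(** Otherwise M = 0, so O and its fraction field both reduce to the constants, against the
    transcendence of x. *)
Lemma gen_neq0 : t != 0.
Proof.
apply/eqP => t0.
have Osc f : O f -> exists c, f = sc c.
  move=> /(rlr_residue OM) [c /(proj2 t_gen) [q _]]; rewrite t0 mul0r => /eqP.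
  by rewrite subr_eq0 => /eqP ->; exists c.
have [g [h [/Osc [c ->] /Osc [d ->] _ xE]]] := rlr_frac OM K0x.
have /x_transc : 'X - (c / d)%:P != 0 by rewrite polyXsubC_eq0.
rewrite rmorphB /= map_polyX map_polyC root_XsubC xE => /eqP; apply.
exact/esym/fmorph_div.
Qed.

Definition ge_at (z : int) f := exists2 u, O u & f = u * t ^ z.
Definition ord_at (z : int) f := exists2 u, lunit u & f = u * t ^ z.

Lemma ord_ge z f : ord_at z f -> ge_at z f.
Proof. by move=> [u [Ou _] ->]; exists u. Qed.

Lemma ge_at0 z : ge_at z 0.
Proof. by exists 0; [apply: rlr0|rewrite mul0r]. Qed.

Lemma ge_atD z f g : ge_at z f -> ge_at z g -> ge_at z (f + g).
Proof.
move=> [u Ou ->] [v Ov ->]; exists (u + v); last by rewrite mulrDl.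
exact: (rlrD OM).
Qed.

Lemma ge_atM z z' f g : ge_at z f -> ge_at z' g -> ge_at (z + z') (f * g).
Proof.
move=> [u Ou ->] [v Ov ->]; exists (u * v); first exact: (rlrM OM).
by rewrite expfzDr ?gen_neq0 // mulrACA.
Qed.

Lemma ge_at_le z z' f : z' <= z -> ge_at z f -> ge_at z' f.
Proof.
move=> zz [u Ou ->]; exists (u * t ^ (z - z')).
  apply: (rlrM OM) => //; have : 0 <= z - z' by rewrite subr_ge0.
  by case: (z - z') => // n _; apply: rlrX; apply: (rlr_max OM); case: t_gen.
by rewrite -mulrA -expfzDr ?gen_neq0 // subrK.
Qed.

Lemma ord_atM z z' f g : ord_at z f -> ord_at z' g -> ord_at (z + z') (f * g).
Proof.
move=> [u Ou ->] [v Ov ->]; exists (u * v); first exact: lunitM.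
by rewrite expfzDr ?gen_neq0 // mulrACA.
Qed.

Lemma ord_atV z f : ord_at z f -> ord_at (- z) f^-1.
Proof.
move=> [u Ou ->]; exists u^-1; first exact: lunitV.
by rewrite invfM invr_expz.
Qed.

Lemma ord_at_sc c : c != 0 -> ord_at 0 (sc c).
Proof. by move=> c0; exists (sc c); [apply: lunit_sc|rewrite mulr1]. Qed.

Lemma ge_at_sc c : ge_at 0 (sc c).
Proof. by exists (sc c); [apply: (rlr_sc OM)|rewrite mulr1]. Qed.

Lemma max_ge u : M u -> exists2 v, O v & u = v * t.
Proof. by move=> /(proj2 t_gen) [q Oq ->]; exists q => //; rewrite mulrC. Qed.

Lemma ge_max v : O v -> M (v * t).
Proof. by move=> Ov; rewrite mulrC; apply: (rlr_maxM OM) => //; case: t_gen. Qed.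

Lemma ord_atP z f : ord_at z f <-> ge_at z f /\ ~ ge_at (z + 1) f.
Proof.
have tz : t ^ z != 0 by rewrite expfz_neq0 ?gen_neq0.
split=> [[u [Ou nu] ->]|[[u Ou ->] nge]].
  split; first by exists u.
  move=> [v Ov]; rewrite addrC expfzDr ?gen_neq0 // mulrA => /(mulIf tz) uE.
  by apply: nu; rewrite uE; apply: ge_max.
exists u => //; split=> // /max_ge [v Ov uE]; apply: nge; exists v => //.
by rewrite uE addrC expfzDr ?gen_neq0 // mulrA.
Qed.

(** The constant is the residue of f / g: subtracting c g cancels the leading term of f. *)
Lemma ord_at_residue z f g : ge_at z f -> ord_at z g ->
  exists c, ge_at (z + 1) (f - sc c * g).
Proof.
move=> [u Ou ->] [v [Ov nv] ->].
have [c] : exists c, M (u / v - sc c).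
  by apply: (rlr_residue OM); apply: (rlrM OM) => //; apply: (rlr_unit OM).
move=> /max_ge [w Ow wE]; exists c, (w * v); first exact: (rlrM OM).
have v0 := notmax_neq0 nv.
have -> : u = (w * t + sc c) * v by rewrite -wE subrK divfK.
by rewrite addrC expfzDr ?gen_neq0 //= expr1z; ring.
Qed.

(** The order of q(t) is the multiplicity of 0 as a root of q: the cofactor q1 satisfies q1(t) =
    q1(0) modulo t, and q1(0) is a nonzero constant. *)
Lemma ord_poly (q : {poly k}) : q != 0 ->
  exists z, ord_at z (map_poly sc q).[t].
Proof.
move=> q0; have [m [q1 q1nr ->]] := multiplicity_XsubC q 0.
rewrite q0 /= in q1nr.
have q00 : q1`_0 != 0 by rewrite -horner_coef0.
exists (0 + m%:Z); rewrite rmorphM hornerM; apply: ord_atM; last first.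
  exists 1; first exact: lunit1.
  by rewrite subr0 rmorphXn /= map_polyX horner_exp hornerX mul1r.
apply/ord_atP.
have [r rO rE] : exists2 r, O r & (map_poly sc q1).[t] = r * t + sc q1`_0.
  move: (q1); elim/poly_ind => [|p c [r rO rE]].
    by exists 0; [apply: rlr0|rewrite coef0 !rmorph0 horner0 mul0r addr0].
  exists (map_poly sc p).[t].
    rewrite rE; apply: (rlrD OM); last exact: rlr_sc.
    by apply: (rlrM OM) => //; apply: (rlr_max OM); case: t_gen.
  rewrite rmorphD rmorphM /= map_polyX map_polyC hornerD hornerMX hornerC.
  by rewrite coefD coefMX coefC eqxx add0r.
have ge1 : ge_at (0 + 1) (r * t) by exists r.
have rt0 : ge_at 0 (r * t) by apply: ge_at_le ge1.
split; first by rewrite rE; apply: ge_atD => //; apply: ge_at_sc.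
rewrite rE => ge2; have [_] := (ord_atP _ _).1 (ord_at_sc q00); apply.
have -> : sc q1`_0 = (r * t + sc q1`_0) + (sc (- 1)) * (r * t).
  by rewrite rmorphN rmorph1; ring.
apply: ge_atD => //; rewrite -[0 + 1](add0r (0 + 1)).
by apply: ge_atM => //; apply: ge_at_sc.
Qed.

Lemma gen_transc (q : {poly k}) : q != 0 -> ~~ root (map_poly sc q) t.
Proof.
move=> /ord_poly [z [u [_ /notmax_neq0 u0] qE]]; rewrite rootE qE.
by rewrite mulf_neq0 // expfz_neq0 // gen_neq0.
Qed.

Lemma ord_adjoin y : y \in adjoin_pred sc t -> y != 0 -> exists z, ord_at z y.
Proof.
move=> /asboolP [p [q ->]]; rewrite mulf_eq0 negb_or invr_eq0 => /andP [p0 q0].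
have [|z zp] := @ord_poly p.
  by apply: contraNneq p0 => ->; rewrite rmorph0 horner0.
have [|z' zq] := @ord_poly q.
  by apply: contraNneq q0 => ->; rewrite rmorph0 horner0.
by exists (z - z'); apply: ord_atM => //; apply: ord_atV.
Qed.

(* A nonzero [f] in all powers of [(t)] would satisfy an equation over [k(t)]
   whose constant term has finite order, yet is divisible by [f]. *)
Lemma gen_separated f : K0 f -> f != 0 -> (forall n : nat, ge_at n f) -> False.
Proof.
move=> K0f f0 f_inf.
have K0t : K0 t by apply: (rlr_sub OM); apply: (rlr_max OM); case: t_gen.
have [q [q0 qf qS]] :=
  alg_over_exchange gen_transc x_transc (K0_alg K0t) (K0_alg K0f).
(* Dividing out the power of the indeterminate, possible as f is nonzero, gives an equation with
   nonzero constant term. *)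
have [m [q1 q1nr qE]] := multiplicity_XsubC q 0.
rewrite q0 /= in q1nr.
have q1S i : q1`_i \in adjoin_pred sc t.
  by have := qS (i + m)%N; rewrite qE subr0 coefMXn ltnNge leq_addl /= addnK.
have q1f : root q1 f.
  move: qf; rewrite qE subr0 rootM => /orP [//|].
  by rewrite rootE hornerXn expf_eq0 (negPf f0) andbF.
have [z0 z0q] : exists z, ord_at z q1`_0.
  by apply: ord_adjoin => //; rewrite -horner_coef0.
have [z zq] : exists z, forall i, ge_at z q1`_i.
  suff [z zq] : exists z, forall i, (i < size q1)%N -> ge_at z q1`_i.
    exists z => i; have [/zq //|i_ge] := ltnP i (size q1).
    by rewrite nth_default //; apply: ge_at0.
  elim: (size q1) => [|n [z zn]]; first by exists 0.
  have [z' z'n] : exists z', ge_at z' q1`_n.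
    have [->|/(ord_adjoin (q1S n)) [z' /ord_ge]] := eqVneq q1`_n 0.
      by exists 0; apply: ge_at0.
    by exists z'.
  exists (Num.min z z') => i; rewrite ltnS leq_eqVlt => /predU1P [->|/zn zi].
    by apply: ge_at_le z'n; rewrite ge_min lexx orbT.
  by apply: ge_at_le zi; rewrite ge_min lexx.
have Of : ge_at 0 f := f_inf 0%N.
have q1E : q1`_0 = - (f * (\sum_(i < (size q1).-1) q1`_i.+1 * f ^+ i)).
  move/rootP: q1f; rewrite horner_coef.
  have : (0 < size q1)%N.
    by rewrite size_poly_gt0; apply: contraNneq q1nr => ->; rewrite root0.
  case: (size q1) => // n _; rewrite big_ord_recl mulr1 => /eqP.
  rewrite addr_eq0 => /eqP ->; congr (- _); rewrite mulr_sumr.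
  by apply: eq_bigr => i _; rewrite /= exprS mulrCA.
have [_] := (ord_atP _ _).1 z0q; apply.
have [n nz] : exists n : nat, z0 + 1 <= n%:Z + z by exists (absz (z0 + 1 - z)%R); lia.
apply: (ge_at_le nz); rewrite q1E -mulN1r -(rmorph1 sc) -rmorphN.
rewrite -[n%:Z + z]add0r; apply: ge_atM; first exact: ge_at_sc.
apply: ge_atM => //; elim/big_ind: _ => [|? ?|i _]; first exact: ge_at0.
  exact: ge_atD.
rewrite -[z]addr0; apply: ge_atM => //.
elim: (nat_of_ord i) => [|j IHj].
  by rewrite expr0 -(rmorph1 sc); apply: ge_at_sc.
by rewrite exprS -[0]addr0; apply: ge_atM.
Qed.

(** If f had no order, membership in the n-th power of (t) would always improve to the next power,
    contradicting [gen_separated]. *)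
Lemma ord_local f : O f -> f != 0 -> exists z, ord_at z f.
Proof.
move=> Of f0; apply: contrapT => nord.
apply: (@gen_separated f) => //; first exact: (rlr_sub OM).
elim=> [|n IHn]; first by exists f => //; rewrite mulr1.
apply: contrapT => nge; apply: nord; exists n%:Z; apply/ord_atP; split=> //.
by rewrite -PoszD addn1.
Qed.

Lemma ord_exists f : K0 f -> f != 0 -> exists z, ord_at z f.
Proof.
move=> /(rlr_frac OM) [g [h [Og Oh h0 ->]]]; rewrite mulf_eq0 negb_or => /andP [g0 _].
have [z zg] := ord_local Og g0; have [z' zh] := ord_local Oh h0.
by exists (z - z'); apply: ord_atM => //; apply: ord_atV.
Qed.

(** Two generators of M differ by a unit, so the order does not depend on the uniformizer; this lets
    one be fixed at each point. *)
Lemma ord_at_anygen s u z : principal_gen s -> lunit u -> ord_at z (u * s ^ z).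
Proof.
move=> [Ms s_gen] uu; have [Mt tg] := t_gen.
have [q Oq sE] := tg _ Ms; have [q' Oq' tE] := s_gen _ Mt.
have uq : lunit q.
  split=> //; apply: (@unit_notmax _ q') => //.
  by apply: (mulfI gen_neq0); rewrite mulr1 mulrA -sE.
exists (u * q ^ z); first by apply: lunitM => //; apply: lunitXz.
by rewrite sE expfzMl mulrA mulrAC.
Qed.

End LocalRingWithResidueField.

(** * Valuations on a smooth curve *)

(* [K0] is the function field inside [K], [ge P z f] says that [f] lies in
   t^z O_P for a uniformizer t at [P], and [ord P z f] that its order is [z]. *)
Record places (k K : fieldType) (sc : {rmorphism k -> K}) (T : Type)
    (K0 : K -> Prop) (ge ord : T -> int -> K -> Prop) : Prop := Places {
  pl_sc : forall c, K0 (sc c);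
  pl_D : forall f g, K0 f -> K0 g -> K0 (f + g);
  pl_M : forall f g, K0 f -> K0 g -> K0 (f * g);
  pl_V : forall f, K0 f -> K0 f^-1;
  pl_geD : forall P z f g, ge P z f -> ge P z g -> ge P z (f + g);
  pl_geM : forall P z z' f g, ge P z f -> ge P z' g -> ge P (z + z') (f * g);
  pl_le : forall P z z' f, z' <= z -> ge P z f -> ge P z' f;
  pl_ge0 : forall P z, ge P z 0;
  pl_ge_sc : forall P c, ge P 0 (sc c);
  pl_ordP : forall P z f, ord P z f <-> ge P z f /\ ~ ge P (z + 1) f;
  pl_ordM : forall P z z' f g,
    ord P z f -> ord P z' g -> ord P (z + z') (f * g);
  pl_ordV : forall P z f, ord P z f -> ord P (- z) f^-1;
  pl_ord_sc : forall P c, c != 0 -> ord P 0 (sc c);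
  pl_residue : forall P z f g, ge P z f -> ord P z g ->
    exists c, ge P (z + 1) (f - sc c * g);
  pl_exists : forall P f, K0 f -> f != 0 -> exists z, ord P z f }.

(** * The places given by the points of a smooth curve *)

Section Bridge.
Variables (k : closedFieldType) (N : nat) (C : smooth_curve k N).
Local Notation K := (hfrac C : fieldType).

Lemma hclass_is_zmod_morphism : zmod_morphism (@hclass k N C : _ -> K).
Proof. by move=> F G; rewrite /hclass !rmorphB. Qed.
Lemma hclass_is_monoid_morphism : monoid_morphism (@hclass k N C : _ -> K).
Proof. by split=> [|F G]; rewrite /hclass ?rmorph1 // !rmorphM. Qed.

Definition hcls_fun : {mpoly k[N.+1]} -> K := @hclass k N C.
HB.instance Definition _ := GRing.isZmodMorphism.Build _ _ hcls_fun
  hclass_is_zmod_morphism.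
HB.instance Definition _ := GRing.isMonoidMorphism.Build _ _ hcls_fun
  hclass_is_monoid_morphism.
Definition hcls : {rmorphism {mpoly k[N.+1]} -> K} := hcls_fun.

Lemma hcls_ideal F : hcls F = 0 -> F \in variety_ideal C.
Proof.
move/eqP; rewrite /hcls /hcls_fun /hclass /= tofrac_eq0.
by rewrite -[X in X \in _]subr0 Quotient.idealrBE rmorph0.
Qed.

(** On the line spanned by v a form of degree d restricts to the single term F(v) X^d. *)
Lemma vanishes_homog (p : proj_point k N) d (F : {mpoly k[N.+1]}) :
  F \is d.-homog -> vanishes_at F p <-> F.@[point_vec p 0] = 0.
Proof.
move=> hF; split=> [F0|F0]; first by rewrite F0 ?memv_pick.
apply/vanishes_rayP/polyP => e; rewrite coef_ray coef0.
have [<-|ne] := eqVneq d e; first by rewrite pihomog_dE.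
by rewrite (pihomog_ne0 (d := d)) ?meval0.
Qed.

Lemma hcls_ev (P : C) F : hcls F = 0 -> F.@[point_vec (val P) 0] = 0.
Proof.
move=> /hcls_ideal /asboolP /(_ (val P) (set_mem (valP P))); apply.
by rewrite memv_pick.
Qed.


Let sc : {rmorphism k -> K} := @hom_scalar _ _ _ hcls.

Lemma local_ringE (P : C) (f : K) : local_ring (val P) f <-> hom_local hcls (val P) f.
Proof.
split=> -[d [F [G [hF hG nG fE]]]]; exists d, F, G.
  split; [exact: hF|exact: hG| |exact: fE].
  by apply/eqP => /(vanishes_homog _ hG).
split; [exact: hF|exact: hG| |exact: fE].
by move=> /(vanishes_homog _ hG) /eqP; apply/negP.
Qed.

Lemma max_idealE (P : C) (f : K) : max_ideal (val P) f <-> hom_max hcls (val P) f.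
Proof.
split=> -[d [F [G [hF hG nG F0 fE]]]]; exists d, F, G.
  split; [exact: hF|exact: hG| | |exact: fE].
    by apply/eqP => /(vanishes_homog _ hG).
  exact/(vanishes_homog _ hF).
split; [exact: hF|exact: hG| | |exact: fE].
  by move=> /(vanishes_homog _ hG) /eqP; apply/negP.
exact/(vanishes_homog _ hF).
Qed.

Lemma function_fieldE (f : K) : function_field f <-> hom_field hcls f.
Proof.
split=> -[d [F [G [hF hG nG fE]]]]; exists d, F, G;
  split; [exact: hF|exact: hG|exact: nG|exact: fE|exact: hF|exact: hG|exact: nG|exact: fE].
Qed.

Lemma local_ring_ext (P : C) : @local_ring k N C (val P) = hom_local hcls (val P).
Proof. by apply/funext => f; apply/propext/local_ringE. Qed.

Lemma max_ideal_ext (P : C) : @max_ideal k N C (val P) = hom_max hcls (val P).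
Proof. by apply/funext => f; apply/propext/max_idealE. Qed.

Lemma function_field_ext : @function_field k N C = hom_field hcls.
Proof. by apply/funext => f; apply/propext/function_fieldE. Qed.

Lemma hom_rlr (P : C) :
  residue_local_ring sc (hom_field hcls) (hom_local hcls (val P))
    (hom_max hcls (val P)).
Proof.
have cls_ev := @hcls_ev P.
split.
- exact: hom_local_scalar.
- exact: hom_localM.
- exact: hom_localD.
- exact: hom_max_local.
- exact: hom_maxM.
- exact: hom_max1.
- exact: hom_local_unit.
- exact: hom_residue.
- exact: hom_field_local.
- exact: hom_local_field.
Qed.

Lemma dim_one_hom : exists x : K, [/\ hom_field hcls x,
  forall q : {poly k}, q != 0 -> ~~ root (map_poly sc q) x &
  forall y, hom_field hcls y -> exists2 q : {poly {poly k}}, q != 0 &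
    root (map_poly (fun c : {poly k} => (map_poly sc c).[x]) q) y].
Proof.
have [x [K0x x_tr x_alg]] : dimension_one C by case: (C).
exists x; split.
- exact/function_fieldE.
- exact: x_tr.
- by move=> y /function_fieldE; apply: x_alg.
Qed.

Section WithUniformizers.
Hypothesis has_unif : forall P : C, exists t : K, uniformizer P t.

Definition unif (P : C) : K := projT1 (cid (has_unif P)).

Lemma unif_gen (P : C) :
  principal_gen (hom_local hcls (val P)) (hom_max hcls (val P)) (unif P).
Proof.
rewrite /unif; case: (cid _) => t /=.
by rewrite /uniformizer max_ideal_ext local_ring_ext.
Qed.

Definition pge (P : C) : int -> K -> Prop :=
  ge_at (hom_local hcls (val P)) (unif P).

Lemma has_ordE (P : C) (f : K) (z : int) : has_ord P f z <->
  ord_at (hom_local hcls (val P)) (hom_max hcls (val P)) (unif P) z f.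
Proof.
rewrite /has_ord /uniformizer max_ideal_ext local_ring_ext.
have [x [K0x x_tr x_alg]] := dim_one_hom.
split=> [[s [u [s_gen Ou nu ->]]]|[u [Ou nu] ->]].
  exact: (ord_at_anygen (hom_rlr P) x_tr K0x (unif_gen P) z s_gen (conj Ou nu)).
by exists (unif P), u; split; [exact: unif_gen| | |].
Qed.

Definition pord (P : C) (z : int) (f : K) : Prop := has_ord P f z.

Lemma curve_places : places sc (@function_field k N C : K -> Prop) pge pord.
Proof.
have [x [K0x x_tr x_alg]] := dim_one_hom.
have pordE P z f : pord P z f <->
    ord_at (hom_local hcls (val P)) (hom_max hcls (val P)) (unif P) z f.
  exact: has_ordE.
rewrite function_field_ext; split.
- exact: hom_field_scalar.
- exact: hom_fieldD.
- exact: hom_fieldM.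
- exact: hom_fieldV.
- by move=> P z f g; apply: (ge_atD (hom_rlr P)).
- by move=> P z z' f g; apply: (ge_atM (hom_rlr P) x_tr K0x (unif_gen P)).
- by move=> P z z' f; apply: (ge_at_le (hom_rlr P) x_tr K0x (unif_gen P)).
- by move=> P z; apply: (ge_at0 (hom_rlr P)).
- by move=> P c; apply: (ge_at_sc (hom_rlr P)).
- move=> P z f; rewrite pordE.
  exact: (ord_atP (hom_rlr P) x_tr K0x (unif_gen P)).
- move=> P z z' f g /pordE of_ /pordE og; apply/pordE.
  exact: (ord_atM (hom_rlr P) x_tr K0x (unif_gen P)).
- by move=> P z f /pordE of_; apply/pordE; apply: (ord_atV (hom_rlr P)).
- by move=> P c c0; apply/pordE; apply: (ord_at_sc (hom_rlr P)).
- move=> P z f g fz /pordE gz.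
  exact: (ord_at_residue (hom_rlr P) x_tr K0x (unif_gen P)).
- move=> P f K0f f0.
  have [z /pordE] := ord_exists (hom_rlr P) x_tr K0x x_alg (unif_gen P) K0f f0.
  by exists z.
Qed.

End WithUniformizers.
End Bridge.

(** * Linear independence *)

Section LinearIndependence.
Variables (k K : fieldType) (sc : {rmorphism k -> K}).
Implicit Types V W : K -> Prop.

Definition lincomb n (e : 'I_n -> K) (c : 'I_n -> k) := \sum_i sc (c i) * e i.
Definition indep n (e : 'I_n -> K) :=
  forall c, lincomb e c = 0 -> forall i, c i = 0.
Definition lin_closed V :=
  V 0 /\ forall c f g, V f -> V g -> V (f + sc c * g).
(** Bounds the dimension from above without presupposing a finite basis; [has_dim] provides one. *)
Definition dim_le V m := forall n (e : 'I_n -> K),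
  (forall i, V (e i)) -> indep e -> (n <= m)%N.
Definition has_dim V m := exists e : 'I_m -> K,
  indep e /\ V = [set lincomb e c | c in [set: 'I_m -> k]].

Lemma lin_closedZ V c f : lin_closed V -> V f -> V (sc c * f).
Proof. by move=> [V0 VD] Vf; rewrite -[_ * f]add0r; apply: VD. Qed.

Lemma lin_closed_comb V n (e : 'I_n -> K) c : lin_closed V ->
  (forall i, V (e i)) -> V (lincomb e c).
Proof.
move=> linV Ve; rewrite /lincomb; elim/big_ind: _ => [|f g Vf Vg|i _].
- by case: linV.
- by rewrite -[g]mul1r -(rmorph1 sc); apply: linV.2.
- exact: lin_closedZ.
Qed.

Lemma dim_le_sub V W m : (forall f, W f -> V f) -> dim_le V m -> dim_le W m.
Proof. by move=> WV Vm n e We; apply: Vm => i; apply: WV. Qed.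

Lemma dim_le_mul V W m h : h != 0 -> (forall f, W f -> V (h * f)) ->
  dim_le V m -> dim_le W m.
Proof.
move=> h0 WV Vm n e We indepe; apply: (Vm n (fun i => h * e i)) => [i|c].
  exact: WV.
rewrite /lincomb => cE; apply: indepe; apply: (mulfI h0).
by rewrite mulr0 mulr_sumr -[RHS]cE; apply: eq_bigr => i _; rewrite mulrCA.
Qed.

(** The coordinate matrix of more than m vectors has a nonzero left kernel, which is a linear
    relation between them. *)
Lemma has_dim_le V m : has_dim V m -> dim_le V m.
Proof.
move=> [e [indepe ->]] n f Vf indepf; rewrite leqNgt; apply/negP => mn.
have /choice [A AE] : forall j, exists c, f j = lincomb e c.
  by move=> j; have [c _ cE] := Vf j; exists c.
pose B := \matrix_(j < n, i < m) A j i.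
have /rowV0Pn [v /sub_kermxP vB v0] : kermx B != 0.
  rewrite -mxrank_eq0 mxrank_ker subn_eq0 -ltnNge.
  exact: leq_ltn_trans (rank_leq_col B) mn.
case/negP: v0; apply/eqP/rowP => j; rewrite mxE.
apply: (indepf (fun j => v 0 j)).
rewrite /lincomb; under eq_bigr do rewrite AE /lincomb mulr_sumr.
rewrite exchange_big big1 //= => i _.
move/rowP/(_ i): vB; rewrite !mxE => vB.
under eq_bigr do rewrite mulrA -rmorphM.
rewrite -mulr_suml -rmorph_sum /= (eq_bigr (fun j => v 0 j * B j i)).
  by rewrite vB rmorph0 mul0r.
by move=> l _; rewrite mxE.
Qed.

(** Adjoining a vector outside the span would give m + 1 independent elements of V. *)
Lemma indep_span V m (e : 'I_m -> K) f : dim_le V m -> (forall i, V (e i)) ->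
  indep e -> V f -> exists c, f = lincomb e c.
Proof.
move=> Vm Ve indepe Vf; apply: contrapT => nf.
pose e' (i : 'I_m.+1) := oapp e f (unlift ord0 i).
have : (m.+1 <= m)%N; last by rewrite ltnn.
apply: (Vm _ e') => [i|c]; first by rewrite /e'; case: unliftP => /=.
rewrite /lincomb big_ord_recl {1}/e' unlift_none /= => cE.
have c0 : c ord0 = 0.
  apply/eqP/negP => /negP c0; apply: nf.
  exists (fun i => - (c ord0)^-1 * c (fintype.lift ord0 i)).
  have sc0 : sc (c ord0) != 0 by rewrite fmorph_eq0.
  apply: (mulfI sc0); move/eqP: cE; rewrite addr_eq0 => /eqP ->.
  rewrite -sumrN /lincomb mulr_sumr; apply: eq_bigr => i _.
  rewrite /e' liftK /= mulrA -rmorphM -mulNr -rmorphN; congr (sc _ * _).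
  by rewrite mulNr mulrN mulVKf.
move=> i; case: (unliftP ord0 i) => [j ->|-> //].
apply: (indepe (fun j => c (fintype.lift ord0 j))).
rewrite -[RHS]cE c0 rmorph0 mul0r add0r.
by apply: eq_bigr => l _; rewrite /e' liftK.
Qed.

Lemma dim_le_has_dim V m : lin_closed V -> dim_le V m ->
  exists2 n, (n <= m)%N & has_dim V n.
Proof.
move=> linV Vm.
pose P n := `[< exists e : 'I_n -> K, (forall i, V (e i)) /\ indep e >].
have P0 : exists n, P n.
  exists 0%N; apply/asboolP; exists (fun _ => 0); split; first by case.
  by move=> c _ [].
have Pm n : P n -> (n <= m)%N by move=> /asboolP [e [Ve]]; apply: Vm.
case: (ex_maxnP P0 Pm) => n /asboolP [e [Ve indepe]] nmax; exists n.
  exact: (Vm _ e).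
exists e; split => //; apply/seteqP; split => f.
  move=> Vf; suff [c ->] : exists c, f = lincomb e c by exists c.
  apply: (indep_span (V := V)) => // l e' Ve' indepe'; apply: nmax.
  by apply/asboolP; exists e'.
by move=> [c _ <-]; apply: lin_closed_comb.
Qed.

Lemma has_dim_indep V m : has_dim V m ->
  exists2 e : 'I_m -> K, (forall i, V (e i)) & indep e.
Proof.
move=> [e [indepe ->]]; exists e => // i.
exists (fun j => (j == i)%:R) => //; rewrite /lincomb (bigD1 i) //= eqxx.
rewrite rmorph1 mul1r big1 ?addr0 // => j /negPf ->.
by rewrite rmorph0 mul0r.
Qed.

Lemma indep_neq0 n (e : 'I_n -> K) i : indep e -> e i != 0.
Proof.
move=> indepe; apply/eqP => ei; have := indepe (fun j => (j == i)%:R).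
rewrite /lincomb big1 => [/(_ erefl i)/eqP|j _]; first by rewrite eqxx oner_eq0.
by have [->|_] := eqVneq j i; rewrite ?ei ?mulr0 ?rmorph0 ?mul0r.
Qed.

(** If some member of an independent family of W lies outside V, subtracting multiples of it moves
    all the others into V and keeps them independent. *)
Lemma dim_le_codim1 V W m : lin_closed V -> lin_closed W ->
  (forall f g, W f -> W g -> ~ V g -> exists c, V (f - sc c * g)) ->
  dim_le V m -> dim_le W m.+1.
Proof.
move=> linV linW codim Vm [|n] // e We indepe; rewrite ltnS.
have [Ve|] := pselect (forall i, V (e i)); first exact/ltnW/(Vm _ e).
move=> /existsNP [i0 nV].
have /choice [a aP] j : exists c, V (e (fintype.lift i0 j) - sc c * e i0).
  exact: codim.
apply: (Vm _ _ aP) => c cE j.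
(* The relation between the corrected vectors, read as a relation of the original family: the
   coefficient at [i0] collects the corrections. *)
pose c' i := oapp c (- \sum_j c j * a j) (unlift i0 i).
have -> : c j = c' (fintype.lift i0 j) by rewrite /c' liftK.
apply: indepe; rewrite -cE /lincomb (bigD1_ord i0) //= {1}/c' unlift_none /=.
under [RHS]eq_bigr do rewrite mulrBr mulrA.
rewrite sumrB -mulr_suml addrC rmorphN mulNr rmorph_sum; congr (_ - _ * _).
  by apply: eq_bigr => l _; rewrite /c' liftK.
by apply: eq_bigr => l _; rewrite rmorphM.
Qed.

End LinearIndependence.

(** * Consequences of the Riemann inequality *)

Section Divisors.
Variables (k K : fieldType) (sc : {rmorphism k -> K}) (T : choiceType).
Variables (K0 : K -> Prop) (ge ord : T -> int -> K -> Prop).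
Hypothesis AX : places sc K0 ge ord.
Implicit Types (D E : {freeg T}) (P Q R : T).

(** The Riemann-Roch space L(D); the zero function needs no separate clause, since [ge] holds for 0
    at every level. *)
Definition Lsp D f := K0 f /\ forall P, ge P (- coeff P D) f.

Lemma ge_scM P z c f : ge P z f -> ge P z (sc c * f).
Proof. by move=> fz; rewrite -[z]add0r; apply: (pl_geM AX _ fz); apply: (pl_ge_sc AX _ _). Qed.

Lemma ge_add1 P z f : ge P z f -> ~ ord P z f -> ge P (z + 1) f.
Proof. by move=> fz nord; apply: contrapT => nge; apply: nord; apply/(pl_ordP AX). Qed.

Lemma ord_neq0 P z f : ord P z f -> f != 0.
Proof.
move=> /(pl_ordP AX) [_ nge]; apply/eqP => f0; apply: nge; rewrite f0.
exact: (pl_ge0 AX _ _).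
Qed.

Lemma ord_ge_le P z z' f : ord P z f -> ge P z' f -> z' <= z.
Proof.
move=> /(pl_ordP AX) [_ nge] fz'; rewrite leNgt; apply/negP => zz'; apply: nge.
by apply: (pl_le AX _ fz'); lia.
Qed.

Lemma ord_pl_ge P z f : ord P z f -> ge P z f.
Proof. by case/(pl_ordP AX). Qed.

Lemma ord_inj P z z' f : ord P z f -> ord P z' f -> z = z'.
Proof.
move=> fz fz'; apply/eqP; rewrite eq_le.
by rewrite (ord_ge_le fz' (ord_pl_ge fz)) (ord_ge_le fz (ord_pl_ge fz')).
Qed.

Lemma ordX P z f n : ord P z f -> ord P (z *+ n) (f ^+ n).
Proof.
move=> fz; elim: n => [|n IHn].
  by rewrite mulr0n expr0 -(rmorph1 sc); apply: (pl_ord_sc AX _ _); rewrite oner_eq0.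
by rewrite mulrS exprS; apply: (pl_ordM AX fz IHn).
Qed.

Lemma geX P f n : ge P 0 f -> ge P 0 (f ^+ n).
Proof.
move=> fz; elim: n => [|n IHn].
  by rewrite expr0 -(rmorph1 sc); apply: (pl_ge_sc AX _ _).
by rewrite exprS -[0]addr0; apply: (pl_geM AX _ IHn).
Qed.

Lemma K0_1 : K0 1.
Proof. by rewrite -(rmorph1 sc); apply: (pl_sc AX _). Qed.

Lemma K0_0 : K0 0.
Proof. by rewrite -(rmorph0 sc); apply: (pl_sc AX _). Qed.

Lemma K0X f n : K0 f -> K0 (f ^+ n).
Proof.
move=> K0f; elim: n => [|n IHn]; first exact: K0_1.
by rewrite exprS; apply: (pl_M AX _ IHn).
Qed.

Lemma Lsp_lin D : lin_closed sc (Lsp D).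
Proof.
split=> [|c f g [K0f fD] [K0g gD]].
  by split=> [|P]; [apply: K0_0|apply: (pl_ge0 AX _ _)].
split=> [|P]; last by apply: (pl_geD AX _ _) => //; apply: ge_scM.
by apply: (pl_D AX _ _) => //; apply: (pl_M AX _ _) => //; apply: (pl_sc AX _).
Qed.

Lemma Lsp_le D E f : (forall P, coeff P D <= coeff P E) -> Lsp D f -> Lsp E f.
Proof.
by move=> DE [K0f fD]; split=> // P; apply: (pl_le AX _ (fD P)); rewrite lerN2.
Qed.

Lemma coeff_pt P Q : coeff P (<< Q >> : {freeg T}) = (Q == P)%:R.
Proof. by rewrite coeffU mul1r. Qed.

Lemma LspP P m f : Lsp (<< P >> *+ m) f <->
  [/\ K0 f, ge P (- m%:Z) f & forall R, R != P -> ge R 0 f].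
Proof.
have cP : coeff P (<< P >> *+ m : {freeg T}) = m%:Z.
  by rewrite coeffMn coeff_pt eqxx; lia.
have cR R : R != P -> coeff R (<< P >> *+ m : {freeg T}) = 0.
  by move=> RP; rewrite coeffMn coeff_pt eq_sym (negPf RP) mul0rn.
split=> [[K0f fD]|[K0f fP fR]].
  split=> // [|R RP]; first by rewrite -cP.
  by rewrite -[0]oppr0 -(cR _ RP).
split=> // R; have [->|RP] := eqVneq R P; first by rewrite cP.
by rewrite cR // oppr0; apply: fR.
Qed.

(** A function of L(D + P) outside L(D) has the extreme pole order at P, so its multiples cancel the
    leading term there of every other function in L(D + P). *)
Lemma Lsp_add_point D P m :
  dim_le sc (Lsp D) m -> dim_le sc (Lsp (D + << P >>)) m.+1.
Proof.
apply: (dim_le_codim1 (Lsp_lin _) (Lsp_lin _)) => f g Lf Lg ngD.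
have [K0g gD] := Lg; have [K0f fD] := Lf.
have zE : - coeff P (D + << P >>) + 1 = - coeff P D.
  by rewrite coeffD coeff_pt eqxx; lia.
have offE R : R != P -> coeff R (D + << P >>) = coeff R D.
  by move=> RP; rewrite coeffD coeff_pt eq_sym (negPf RP) addr0.
have gP : ord P (- coeff P (D + << P >>)) g.
  apply/(pl_ordP AX); split; first exact: gD.
  rewrite zE => gP; apply: ngD; split=> // R.
  by have [->//|RP] := eqVneq R P; rewrite -offE.
have [c fgc] := pl_residue AX (fD P) gP.
exists c; split.
  have [_ linL] := Lsp_lin (D + << P >>).
  by have [] := linL (- c) f g Lf Lg; rewrite rmorphN mulNr.
move=> R; have [->|RP] := eqVneq R P; first by rewrite -zE.
rewrite -offE // -mulNr -rmorphN.
by apply: (pl_geD AX _ _) => //; apply: ge_scM.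
Qed.

(** Listing the points with multiplicity allows induction on E, one point at a time. *)
Lemma effective_list E : (forall P, 0 <= coeff P E) ->
  exists s : seq T, E = \sum_(P <- s) << P >> /\ deg E = (size s)%:Z.
Proof.
move=> E0; suff [s sE] : exists s : seq T, E = \sum_(P <- s) << P >>.
  exists s; split=> //; rewrite sE; elim: (s) => [|P r IHr].
    by rewrite big_nil deg0.
  by rewrite big_cons degD degU IHr.
rewrite -[X in exists s, X = _]freeg_sumE; elim: (dom E) => [|P r [s sE]].
  by exists [::]; rewrite !big_nil.
exists (nseq (absz (coeff P E)) P ++ s); rewrite big_cons sE big_cat /=.
congr (_ + _); rewrite -{1}(gez0_abs (E0 P)).
elim: (absz _) => [|n IHn]; first by rewrite big_nil freegU0.
by rewrite /= big_cons -IHn freegUD.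
Qed.

Lemma Lsp_add_effective D E m d : (forall P, 0 <= coeff P E) ->
  deg E = d%:Z -> dim_le sc (Lsp D) m -> dim_le sc (Lsp (D + E)) (m + d)%N.
Proof.
move=> /effective_list [s [-> ->]] [<-] Dm.
elim: s => [|P s IHs]; first by rewrite big_nil addr0 addn0.
by rewrite big_cons addrCA addrC /= addnS; apply: Lsp_add_point.
Qed.

Lemma deg_effective E : (forall P, 0 <= coeff P E) -> 0 <= deg E.
Proof. by move=> /effective_list [s [_ ->]]. Qed.

Variable g : nat.
Hypothesis genus_ub : forall D m, has_dim sc (Lsp D) m -> deg D + 1 - m%:Z <= g%:Z.
Variables (D0 : {freeg T}) (m0 : nat).
Hypothesis D0_dim : has_dim sc (Lsp D0) m0.

(** D is bounded by D0 plus the positive part of D - D0, and adding an effective divisor raises the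
    dimension by at most its degree. *)
Lemma Lsp_finite D : exists m, dim_le sc (Lsp D) m.
Proof.
have E0 P : 0 <= coeff P (fgpos (D - D0)) by rewrite coeff_fgposE le_max lexx.
have := deg_effective E0; case dE: (deg _) => [d|//] _.
exists (m0 + d)%N; apply: (dim_le_sub _ (Lsp_add_effective E0 dE (has_dim_le D0_dim))).
move=> f; apply: Lsp_le => P; rewrite coeffD coeff_fgposE coeffB.
by rewrite -lerBlDl le_max lexx orbT.
Qed.

Lemma riemann D :
  exists m, has_dim sc (Lsp D) m /\ deg D + 1 - g%:Z <= m%:Z.
Proof.
have [M DM] := Lsp_finite D; have [m _ Dm] := dim_le_has_dim (Lsp_lin D) DM.
by exists m; split=> //; have := genus_ub Dm; lia.
Qed.

Lemma Lsp_mul D E f h : Lsp D f -> Lsp E h -> Lsp (D + E) (f * h).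
Proof.
move=> [K0f fD] [K0h hE]; split=> [|P]; first exact: (pl_M AX _ _).
by rewrite coeffD opprD; apply: (pl_geM AX _ _).
Qed.

Lemma Lsp1 : Lsp 0 1.
Proof.
split=> [|P]; first exact: K0_1.
by rewrite coeff0 oppr0 -(rmorph1 sc); apply: (pl_ge_sc AX _ _).
Qed.

(* A function with [deg D < 0] would embed the spaces [L(-nD)], whose dimension
   is unbounded, into [L(0)] by multiplication with its powers. *)
Lemma Lsp_deg_ge0 D f : Lsp D f -> f != 0 -> 0 <= deg D.
Proof.
move=> Lf f0; rewrite leNgt; apply/negP => D_lt0.
have [M LM] := Lsp_finite 0.
(* As -D has degree at least 1, the Riemann inequality makes the dimension of L(-nD) at least n + 1
   - g = M + 1. *)
pose n := (M + g)%N.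
have Lfn : Lsp (D *+ n) (f ^+ n).
  elim: n => [|i IHi]; first exact: Lsp1.
  by rewrite mulrS exprS; apply: Lsp_mul.
have fn0 : f ^+ n != 0 by rewrite expf_neq0.
have WM : dim_le sc (Lsp (- (D *+ n))) M.
  apply: (dim_le_mul fn0 _ LM) => h Lh; rewrite -(subrr (D *+ n)).
  exact: Lsp_mul.
have [m [/has_dim_indep [e We inde] m_ge]] := riemann (- (D *+ n)).
have mM : (m <= M)%N := WM _ _ We inde.
by move: m_ge; rewrite degN degMn /n; nia.
Qed.

(** E is D + div f. As long as f exceeds the order prescribed by D at some point, that point is
    removed from D; this stops because the degree cannot become negative. The degrees agree because
    f lies in L(D - E) and its inverse in L(E - D). *)
Lemma principal_divisor D f : Lsp D f -> f != 0 -> exists E,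
  [/\ forall P, 0 <= coeff P E, forall P, ord P (coeff P E - coeff P D) f
    & deg E = deg D].
Proof.
move=> Lf f0.
suff [E [E0 EP]] : exists E,
    (forall P, 0 <= coeff P E) /\ (forall P, ord P (coeff P E - coeff P D) f).
  exists E; split=> //; apply/eqP; rewrite eq_le; apply/andP; split.
    suff : 0 <= deg (D - E) by rewrite degB subr_ge0.
    apply: (@Lsp_deg_ge0 _ f) => //; split=> [|P]; first by case: Lf.
    by rewrite coeffB opprB; apply: ord_pl_ge.
  suff : 0 <= deg (E - D) by rewrite degB subr_ge0.
  apply: (@Lsp_deg_ge0 _ f^-1); last by rewrite invr_eq0.
  split=> [|P]; first by apply: (pl_V AX _); case: Lf.
  by rewrite coeffB; apply/ord_pl_ge/(pl_ordV AX).
have [n Dn] : exists n : nat, deg D < n%:Z.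
  by exists (absz (deg D)).+1; lia.
elim: n D Lf Dn => [|n IHn] D Lf Dn.
  by have := Lsp_deg_ge0 Lf f0; lia.
have [ordD|/existsNP [P nord]] := pselect (forall P, ord P (- coeff P D) f).
  by exists 0; split=> P; rewrite coeff0 ?add0r.
have LfP : Lsp (D - << P >>) f.
  have [K0f fD] := Lf; split=> // R; rewrite coeffB coeff_pt.
  have [<-|PR] := eqVneq P R; last by rewrite subr0.
  by rewrite opprB addrC; apply: ge_add1.
have [|E [E0 EP]] := IHn _ LfP; first by rewrite degB degU; lia.
exists (E + << P >>); split=> R; rewrite coeffD coeff_pt.
  by have := E0 R; lia.
have := EP R; rewrite coeffB coeff_pt; congr (ord R _ f); lia.
Qed.

Hypothesis D0_genus : deg D0 + 1 - m0%:Z = g%:Z.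

(** For large m a nonzero h in L(D + mP - D0) makes D + mP equivalent to D0 + E with E effective.
    Hence the dimension is at most m0 + deg E, which is d because D0 attains the genus. *)
Lemma riemann_eq D P : exists M : nat, forall m d : nat, (M <= m)%N ->
  d%:Z = deg D + m%:Z + 1 - g%:Z -> dim_le sc (Lsp (D + << P >> *+ m)) d.
Proof.
(* From here on D + mP - D0 has degree at least g, so its space is nonzero. *)
exists (absz (deg D0 - deg D + g%:Z)%R) => m d Mm dE.
pose D1 := D + << P >> *+ m - D0.
have dD1 : deg D1 = deg D + m%:Z - deg D0.
  by rewrite degB degD degMn degU; lia.
have [l [/has_dim_indep [e Le inde] l_ge]] := riemann D1.
case: l e Le inde l_ge => [|l] e Le inde l_ge; first by rewrite dD1 in l_ge; lia.
have h0 := indep_neq0 ord0 inde; have Lh := Le ord0; set h := e ord0 in h0 Lh.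
have [E [E0 EP dE1]] := principal_divisor Lh h0.
have := deg_effective E0; case dEd: (deg E) => [d'|//] _.
have -> : d = (m0 + d')%N by move: D0_genus; rewrite dEd in dE1; lia.
have hV0 : h^-1 != 0 by rewrite invr_eq0.
apply: (dim_le_mul hV0 _ (Lsp_add_effective E0 dEd (has_dim_le D0_dim))).
move=> w [K0w wD]; split=> [|R].
  by apply: (pl_M AX _ _) => //; apply: (pl_V AX _); case: Lh.
have := pl_geM AX (ord_pl_ge (pl_ordV AX (EP R))) (wD R).
by congr (ge R _ _); rewrite /D1 !coeffB !coeffD; ring.
Qed.

(** For large m, L(mP - Q) has dimension at least m - g and L(mP - 2Q) at most m - g - 1, so some
    function lies in the first space only. *)
Lemma exists_ord1 P Q : P != Q -> exists M : nat, forall m, (M <= m)%N ->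
  exists2 f, Lsp (<< P >> *+ m) f & ord Q 1 f.
Proof.
move=> PQ; have [M LM] := riemann_eq (- (<< Q >> *+ 2)) P.
exists (M + g + 2)%N => m Mm.
have [l [/has_dim_indep [e Le inde] l_ge]] := riemann (<< P >> *+ m - << Q >>).
have [d dE] : exists d : nat, d%:Z = deg (- (<< Q >> *+ 2)) + m%:Z + 1 - g%:Z.
  by exists (m - g - 1)%N; rewrite degN degMn degU; lia.
have Mm' : (M <= m)%N by lia.
have [Le2|/existsNP [i nLe]] :=
    pselect (forall i, Lsp (- (<< Q >> *+ 2) + << P >> *+ m) (e i)).
  have := LM m d Mm' dE _ _ Le2 inde.
  move: dE l_ge; rewrite degN !degMn !degB !degMn !degU; lia.
exists (e i).
  by apply: (Lsp_le _ (Le i)) => R; rewrite coeffB coeff_pt; lia.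
have [K0e eL] := Le i.
apply/(pl_ordP AX); split.
  by have := eL Q; rewrite coeffB coeffMn !coeff_pt eqxx (negPf PQ); congr ge; lia.
move=> e2; apply: nLe; split=> // R.
have := eL R; rewrite !(coeffB, coeffD, coeffN, coeffMn) !coeff_pt.
have [<- _|QR] := eqVneq Q R; last by congr (ge R _ _); lia.
by move: e2; rewrite (negPf PQ); congr (ge Q _ _); lia.
Qed.

End Divisors.

(** * Gaps of a numerical semigroup with two generators *)

Lemma sum_ord_lt n m : (\sum_(i < n) (i < m) = minn n m)%N.
Proof. by elim: n => [|n IHn]; rewrite ?big_ord0 ?big_ord_recr /= ?IHn; lia. Qed.

Lemma sum_ord_between n m : (\sum_(i < n) (0 < i <= m) = minn n.-1 m)%N.
Proof. by elim: n => [|n IHn]; rewrite ?big_ord0 ?big_ord_recr /= ?IHn; lia. Qed.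

Lemma card_between a m : (m < a)%N -> #|[pred j : 'I_a | (0 < j <= m)%N]| = m.
Proof.
move=> ma; rewrite -sum1_card big_mkcond /=.
rewrite (eq_bigr (fun i : 'I_a => (0 < i <= m)%N : nat)).
  by rewrite sum_ord_between; lia.
by move=> i _; rewrite inE; case: ifP.
Qed.

Section Counting.
Variables (a b : nat).
Hypotheses (a_gt0 : (0 < a)%N) (ab : coprime a b).
Local Open Scope nat_scope.

Lemma ndvd_mul j : 0 < j < a -> ~~ (a %| b * j).
Proof.
move=> /andP [j0 ja]; rewrite Gauss_dvdr //; apply/negP => /(dvdn_leq j0).
by rewrite leqNgt ja.
Qed.

(* [b * j / a] rounded up. *)
Let up j := (b * j + a.-1) %/ a.

Lemma up_le i j K : (a * i + b * j <= K * a) = (i + up j <= K).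
Proof.
rewrite /up; have := divn_eq (b * j + a.-1) a; have := ltn_pmod (b * j + a.-1) a_gt0.
by move: (_ %/ _) (_ %% _) => q r ra E; apply/idP/idP => H; nia.
Qed.

(** The fractions b j / a and b (a - j) / a add up to b and are not integers, so rounding both up
    adds exactly 1. *)
Lemma up_rev j : 0 < j < a -> up j + up (a - j) = b.+1.
Proof.
move=> ja; have nd := ndvd_mul ja; rewrite /up.
have := divn_eq (b * j + a.-1) a; have := ltn_pmod (b * j + a.-1) a_gt0.
have := divn_eq (b * (a - j) + a.-1) a.
have := ltn_pmod (b * (a - j) + a.-1) a_gt0.
move: (_ %/ _) (_ %% _) => v s sa E; move: (_ %/ _) (_ %% _) => u r ra F.
have ju : b * j != u * a by apply: contraNneq nd => ->; rewrite dvdn_mull.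
have Eab : b * (a - j) = b * a - b * j by rewrite mulnBr.
have jab : b * j <= b * a by rewrite leq_mul2l; lia.
have h1 : b * a <= (u + v) * a by rewrite mulnDl; lia.
have h2 : (u + v) * a < (b + 2) * a by rewrite !mulnDl; lia.
rewrite leq_pmul2r // in h1; rewrite ltn_pmul2r // in h2.
suff : u + v != b by lia.
apply/eqP => uvb; have h3 : u * a + v * a = b * a by rewrite -mulnDl uvb.
lia.
Qed.

(* The terms for [j] and [a - j] add up to [b + 1]. *)
Lemma sum_up : 2 * (\sum_(j < a) up j) = (a - 1) * (b + 1).
Proof.
rewrite -(big_mkord xpredT up) big_ltn // {1}/up muln0 add0n divn_small; last by lia.
rewrite add0n mul2n -addnn {1}big_nat_rev -big_split /=.
rewrite -sum_nat_const_nat addn1; apply: eq_big_nat => j /andP [j1 ja].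
by rewrite add1n subSS addnC up_rev // j1.
Qed.

(** Each j < a admits K + 1 - [up j] values of i, where b <= K rules out truncation; summing over j
    with [sum_up] gives the count. *)
Lemma card_monomials g K : 2 * g = (a - 1) * (b - 1) -> 0 < b -> b <= K ->
  #|[pred p : 'I_K.+1 * 'I_a | a * p.1 + b * p.2 <= K * a]| + g = K * a + 1.
Proof.
move=> gE b_gt0 bK; rewrite -sum1_card.
rewrite -(pair_big_dep xpredT (fun (i : 'I_K.+1) (j : 'I_a) => a * i + b * j <= K * a)
           (fun _ _ => 1)) /=.
rewrite (exchange_big_dep xpredT) //=.
have E (j : 'I_a) : \sum_(i < K.+1 | a * i + b * j <= K * a) 1 + up j = K.+1.
  rewrite big_mkcond (eq_bigr (fun i : 'I_K.+1 => (i < K.+1 - up j) : nat)).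
    rewrite sum_ord_lt; suff : up j <= K by lia.
    have := up_le 0 j b; have := up_le 0 j K; have := ltn_ord j; nia.
  by move=> i _; rewrite up_le; case: ifP; lia.
have : \sum_(j < a) (\sum_(i < K.+1 | a * i + b * j <= K * a) 1 + up j) = a * K.+1.
  by rewrite (eq_bigr _ (fun j _ => E j)) sum_nat_const card_ord.
rewrite big_split /=; have := sum_up.
set S := \sum_(j < a) up j; set S' := \sum_(j < a) _.
by move=> h1 h2; nia.
Qed.

End Counting.

(** * Combinations of functions with distinct orders at a point *)

Section Combinations.
Variables (k K : fieldType) (sc : {rmorphism k -> K}) (T : choiceType).
Variables (K0 : K -> Prop) (ge ord : T -> int -> K -> Prop).
Hypothesis AX : places sc K0 ge ord.

Lemma ge_sum P z (I : finType) (A : pred I) (F : I -> K) :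
  (forall i, A i -> ge P z (F i)) -> ge P z (\sum_(i | A i) F i).
Proof.
move=> AF; elim/big_ind: _ => [|f g fz gz|//]; first exact: (pl_ge0 AX).
exact: (pl_geD AX).
Qed.

Lemma ord_addl P z f g : ord P z f -> ge P (z + 1) g -> ord P z (f + g).
Proof.
move=> /(pl_ordP AX) [fz nf] gz; apply/(pl_ordP AX); split.
  by apply: (pl_geD AX) => //; apply: (pl_le AX _ gz); lia.
move=> fgz; apply: nf; rewrite -[f](addrK g) -mulN1r -(rmorph1 sc) -rmorphN.
by apply: (pl_geD AX) => //; apply: (ge_scM AX).
Qed.

Lemma ord_scM P z c f : c != 0 -> ord P z f -> ord P z (sc c * f).
Proof.
by move=> c0 fz; rewrite -[z]add0r; apply: (pl_ordM AX) => //; apply: (pl_ord_sc AX).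
Qed.

(** Since the orders are distinct, the term of least order with a nonzero coefficient cannot be
    cancelled. *)
Lemma ord_comb P (I : finType) (A : {pred I}) (e : I -> K) (o : I -> int)
    (c : I -> k) i0 :
  {in A &, injective o} -> (forall i, A i -> ord P (o i) (e i)) ->
  A i0 -> c i0 != 0 ->
  exists i1, [/\ A i1, c i1 != 0, ord P (o i1) (\sum_(i | A i) sc (c i) * e i)
    & forall i, A i -> c i != 0 -> o i1 <= o i].
Proof.
move=> o_inj eo Ai0 ci0.
have Bi0 : A i0 && (c i0 != 0) by rewrite Ai0.
case: (@Order.TotalTheory.arg_minP _ _ I i0 (fun i => A i && (c i != 0)) o Bi0) => i1.
move=> /andP [Ai1 ci1] i1min; exists i1; split=> //; last first.
  by move=> i Ai ci; apply: i1min; rewrite Ai.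
rewrite (bigD1 i1) //=; apply: ord_addl; first by apply: ord_scM => //; apply: eo.
apply: ge_sum => i /andP [Ai ii1].
have [->|ci] := eqVneq (c i) 0; first by rewrite rmorph0 mul0r; apply: (pl_ge0 AX).
have oi : o i1 <= o i by apply: i1min; rewrite Ai.
have oi' : o i1 != o i by apply: contra_neq ii1 => /(o_inj _ _ Ai1 Ai) ->.
apply: (pl_le AX _ (ge_scM AX (c i) (ord_pl_ge AX (eo _ Ai)))).
by rewrite lezD1 lt_neqAle oi'.
Qed.

(** Distinct orders force independence, and as many independent elements as the dimension bound span
    V. *)
Lemma comb_span (V : K -> Prop) P (I : finType) (A : {pred I}) (e : I -> K)
    (o : I -> int) f :
  {in A &, injective o} -> (forall i, A i -> ord P (o i) (e i)) ->
  (forall i, A i -> V (e i)) -> dim_le sc V #|A| -> V f ->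
  exists c : I -> k, f = \sum_(i | A i) sc (c i) * e i.
Proof.
move=> o_inj eo Ve VA Vf.
(* Transports coefficients from the enumeration of A to the index type, with 0 outside A. *)
pose ext (c : 'I_#|A| -> k) i := if [pick j | enum_val j == i] is Some j then c j else 0.
have extE c : lincomb sc (fun j => e (enum_val j)) c
    = \sum_(i | A i) sc (ext c i) * e i.
  rewrite [RHS]big_enum_val; apply: eq_bigr => j _; rewrite /ext.
  case: pickP => [j' /eqP /enum_val_inj ->//|/(_ j)]; by rewrite eqxx.
have [||c ->] := @indep_span _ _ sc V _ (fun j => e (enum_val j)) f VA _ _ Vf.
- by move=> j; apply: Ve; apply: enum_valP.
- move=> c; rewrite extE => c0 j; apply/eqP/negP => /negP cj.
  have extj : ext c (enum_val j) = c j.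
    rewrite /ext; case: pickP => [j' /eqP /enum_val_inj ->//|/(_ j)].
    by rewrite eqxx.
  have [||i1 [_ _]] := @ord_comb P I A e o (ext c) (enum_val j) o_inj eo.
  + exact: enum_valP.
  + by rewrite extj.
  by rewrite c0 => /(ord_neq0 AX); rewrite eqxx.
- by exists (ext c).
Qed.

End Combinations.

(** * Functions with a pole only at P *)

Section TotallyRamifiedPoint.
Variables (k K : fieldType) (sc : {rmorphism k -> K}) (T : choiceType).
Variables (K0 : K -> Prop) (ge ord : T -> int -> K -> Prop).
Hypothesis AX : places sc K0 ge ord.
Local Notation Lsp := (Lsp K0 ge).

Variable g : nat.
Hypothesis genus_ub :
  forall D m, has_dim sc (Lsp D) m -> deg D + 1 - m%:Z <= g%:Z.
Variables (D0 : {freeg T}) (m0 : nat).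
Hypothesis D0_dim : has_dim sc (Lsp D0) m0.
Hypothesis D0_genus : deg D0 + 1 - m0%:Z = g%:Z.

Variables (P Q : T) (a b : nat).
Hypotheses (PQ : P != Q) (a_gt1 : (1 < a)%N) (b_gt0 : (0 < b)%N).
Hypotheses (ab : coprime a b) (gE : (2 * g = (a - 1) * (b - 1))%N).
Variables x y : K.
Hypotheses (K0x : K0 x) (xP : ord P (- a%:Z) x) (xQ : ord Q a%:Z x).
Hypothesis xR : forall R, R != P -> R != Q -> ord R 0 x.
Hypotheses (K0y : K0 y) (yP : ord P (- b%:Z) y).
Hypotheses (yR : forall R, R != P -> ge R 0 y) (yQ : ge Q 1 y).

Let a_gt0 : (0 < a)%N. Proof. exact: ltnW. Qed.

Lemma xR_ge R : R != P -> ge R 0 x.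
Proof.
move=> RP; have [->|RQ] := eqVneq R Q; last exact/(ord_pl_ge AX)/xR.
by apply: (pl_le AX _ (ord_pl_ge AX xQ)).
Qed.

Lemma monomial_ord i j : ord P (- (a * i + b * j)%N%:Z) (x ^+ i * y ^+ j).
Proof.
have := pl_ordM AX (ordX AX i xP) (ordX AX j yP).
by congr (ord P _ _); rewrite !mulNrn; lia.
Qed.

Lemma monomial_K0 i j : K0 (x ^+ i * y ^+ j).
Proof. by apply: (pl_M AX); apply: (K0X AX). Qed.

Lemma monomial_ge R i j : R != P -> ge R 0 (x ^+ i * y ^+ j).
Proof.
move=> RP; rewrite -[0]addr0; apply: (pl_geM AX); apply: (geX AX); last exact: yR.
exact: xR_ge.
Qed.

Local Notation mono n := ([pred p : 'I_n.+1 * 'I_a | (a * p.1 + b * p.2 <= n * a)%N]).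
Local Notation mon p := (x ^+ p.1 * y ^+ p.2).

Lemma monomial_inj i i' j j' : (j < a)%N -> (j' < a)%N ->
  (a * i + b * j = a * i' + b * j')%N -> i = i' /\ j = j'.
Proof.
wlog jj : i i' j j' / (j <= j')%N.
  move=> H ja ja' E; have [jj|/ltnW jj] := leqP j j'; first exact: H.
  by have [-> ->] := H _ _ _ _ jj ja' ja (esym E).
move=> ja ja' E.
have [j0|j0] := posnP (j' - j)%N; first by split; nia.
have /negP [] : ~~ (a %| b * (j' - j))%N by apply: ndvd_mul => //; lia.
have -> : (b * (j' - j) = a * (i - i'))%N by rewrite !mulnBr; lia.
exact: dvdn_mulr.
Qed.

Lemma monomial_ord_inj n : {in mono n &, injective
  (fun p : 'I_n.+1 * 'I_a => - (a * p.1 + b * p.2)%N%:Z)}.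
Proof.
move=> [i j] [i' j'] _ _ /= /eqP; rewrite eqr_opp => /eqP [E].
have [ii jj] := monomial_inj (ltn_ord j) (ltn_ord j') E.
by congr (_, _); apply: val_inj.
Qed.

Lemma monomial_span : exists M : nat, forall n, (M <= n)%N ->
  forall f, Lsp (<< P >> *+ (n * a)) f ->
  exists c : 'I_n.+1 * 'I_a -> k, f = \sum_(p | mono n p) sc (c p) * mon p.
Proof.
have [M LM] := riemann_eq AX genus_ub D0_dim D0_genus 0 P.
exists (M + b)%N => n Mn f Lf.
have cardE := card_monomials a_gt0 ab gE b_gt0 (leq_trans (leq_addl _ _) Mn).
apply: (@comb_span _ _ sc _ K0 ge ord AX (Lsp (<< P >> *+ (n * a))) P _
  (mono n) _ _ f (@monomial_ord_inj n)) => //.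
- by move=> p _; apply: monomial_ord.
- move=> [i j] /= ij; apply/LspP; split; [exact: monomial_K0| |].
    by apply: (pl_le AX _ (ord_pl_ge AX (monomial_ord _ _))); rewrite lerN2.
  by move=> R; apply: monomial_ge.
- rewrite -[_ *+ _]add0r; apply: LM; first by nia.
  by rewrite deg0 add0r -(PoszD _ 1) -cardE PoszD addrK.
Qed.

(** No cancellation occurs at P: the pole order of f is the largest one among the monomials that
    occur in it. *)
Lemma monomial_min n c f : f != 0 ->
  f = \sum_(p : 'I_n.+1 * 'I_a | mono n p) sc (c p) * mon p ->
  exists p, [/\ mono n p, ord P (- (a * p.1 + b * p.2)%N%:Z) f &
    forall q, mono n q -> c q != 0 -> (a * q.1 + b * q.2 <= a * p.1 + b * p.2)%N].
Proof.
move=> f0 fE.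
have [p0 /andP [p0A cp0]] : exists p0, mono n p0 && (c p0 != 0).
  apply/existsP; apply: contraNT f0; rewrite negb_exists => /forallP c0.
  rewrite fE big1 // => p pA; have := c0 p; rewrite pA /= negbK => /eqP ->.
  by rewrite rmorph0 mul0r.
have mon_ord (p : 'I_n.+1 * 'I_a) :
    mono n p -> ord P (- (a * p.1 + b * p.2)%N%:Z) (mon p).
  by move=> _; apply: monomial_ord.
have [p [pA cp fp pmin]] := ord_comb AX (@monomial_ord_inj n) mon_ord p0A cp0.
exists p; split=> //; first by rewrite fE.
by move=> q qA cq; have := pmin q qA cq; rewrite lerN2.
Qed.

(* [x] vanishes at [Q] to order at least 2, so the function with a simple zero
   at [Q] provided by Riemann-Roch forces [y] to have a simple zero there. *)
Lemma ord_y : ord Q 1 y.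
Proof.
have [M span] := monomial_span.
have [M' sep] := exists_ord1 AX genus_ub D0_dim D0_genus PQ.
pose n := (M + M')%N.
have [|f Lf fQ] := sep (n * a)%N; first by rewrite /n; nia.
have [|c fE] := span n _ f Lf; first exact: leq_addr.
apply: contrapT => /(ge_add1 AX yQ) y2.
have ge2 i j : (0 < i + j)%N -> ge Q 2 (x ^+ i * y ^+ j).
  have QP : Q != P by rewrite eq_sym.
  case: i => [|i] ij.
    case: j ij => // j _; rewrite mul1r exprS -[2]addr0.
    by apply: (pl_geM AX) => //; apply/(geX AX)/yR.
  rewrite exprS -mulrA -[2]addr0; apply: (pl_geM AX); last exact: monomial_ge.
  by apply: (pl_le AX _ (ord_pl_ge AX xQ)); lia.
pose p00 : 'I_n.+1 * 'I_a := (ord0, Ordinal a_gt0).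
rewrite (bigD1 p00) /= ?muln0 // !expr0 !mulr1 in fE.
set h := (X in _ = _ + X) in fE.
have hQ : ge Q 2 h.
  apply: (ge_sum AX) => -[i j] /andP [_ ij]; apply: (ge_scM AX); apply: ge2.
  rewrite lt0n; apply: contra_neq ij => /eqP; rewrite addn_eq0 => /andP [/eqP i0 /eqP j0].
  by congr (_, _); apply: val_inj.
(* A nonzero constant term would make f a unit at Q, against its simple zero there. *)
have c0 : c p00 = 0.
  apply/eqP/negP => /negP c0.
  have : ord Q 0 f.
    rewrite fE; apply: (ord_addl AX); first exact: (pl_ord_sc AX).
    by apply: (pl_le AX _ hQ).
  by move=> /(ord_inj AX fQ).
case/(pl_ordP AX): fQ => _; apply.
by rewrite fE c0 rmorph0 add0r.
Qed.

(** Monomials divisible by x vanish at Q to order at least a > i, and the pure powers of y have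
    distinct orders there. So y^i occurs in f, and its pole order b i at P is at most ta. *)
Lemma ord_Q_bound t i f : (0 < i < a)%N -> Lsp (<< P >> *+ (t * a)) f ->
  ord Q i%:Z f -> (b * i < t * a)%N.
Proof.
move=> ia Lf fQ; have f0 := ord_neq0 AX fQ.
have [M span] := monomial_span.
pose n := (M + t)%N.
have QP : Q != P by rewrite eq_sym.
have Lnf : Lsp (<< P >> *+ (n * a)) f.
  apply: (Lsp_le AX _ Lf) => R; rewrite !coeffMn coeff_pt /n; case: eqP => _; nia.
have [|c fE] := span n _ f Lnf; first exact: leq_addr.
have [p [pA fP pmax]] := monomial_min f0 fE.
have pt : (a * p.1 + b * p.2 <= t * a)%N.
  have [_ fPt _] := (LspP _ _ _ _ _).1 Lf.
  by have := ord_ge_le AX fP fPt; rewrite lerN2.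
rewrite (bigID (fun p : 'I_n.+1 * 'I_a => p.1 == ord0)) /= in fE.
set f1 := (X in _ = X + _) in fE; set f2 := (X in _ = _ + X) in fE.
have f2Q : ge Q a%:Z f2.
  apply: (ge_sum AX) => -[[[|j] jn] l] /andP [_ ij] //=.
  apply: (ge_scM AX); rewrite exprS -mulrA -[a%:Z]addr0.
  apply: (pl_geM AX); last exact: monomial_ge.
  exact: (ord_pl_ge AX).
(* Without a pure power of y, f would vanish at Q to order at least a. *)
have [q /andP [/andP [qA q1] cq]] : exists q, (mono n q && (q.1 == ord0)) && (c q != 0).
  apply/existsP; apply: contrapT; move/negP; rewrite negb_exists => /forallP c0.
  have f10 : f1 = 0.
    rewrite /f1 big1 // => q qA; have := c0 q; rewrite qA /= negbK => /eqP ->.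
    by rewrite rmorph0 mul0r.
  rewrite f10 add0r in fE; rewrite -fE in f2Q.
  by have := ord_ge_le AX fQ f2Q; lia.
have [||||q' [/andP [q'A /eqP q'1] cq' f1Q _]] := @ord_comb _ _ sc _ K0 ge ord AX Q _
    [pred q | mono n q && (q.1 == ord0)] (fun p : 'I_n.+1 * 'I_a => mon p)
    (fun p : 'I_n.+1 * 'I_a => (p.2 : nat)%:Z) c q.
- move=> [i1 j1] [i2 j2] /andP [_ /= /eqP ->] /andP [_ /= /eqP ->] [jj].
  by congr (_, _); apply: val_inj.
- move=> [i1 j1] /andP [_ /= /eqP ->]; rewrite mul1r.
  have := ordX AX j1 ord_y; congr (ord Q _ _); exact: natz.
- by apply/andP.
- exact: cq.
have fQ' : ord Q q'.2%:Z f.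
  rewrite fE; apply: (ord_addl AX) => //; apply: (pl_le AX _ f2Q).
  by have := ltn_ord q'.2; lia.
have [iE] := ord_inj AX fQ fQ'.
have := leq_trans (pmax _ q'A cq') pt; rewrite q'1 muln0 add0n -iE => bi.
(* Equality would make a divide b i, which coprimality excludes for 0 < i < a. *)
rewrite ltn_neqAle bi andbT; apply: contraNneq (@ndvd_mul a b ab i ia) => ->.
exact: dvdn_mull.
Qed.

Definition pole_order R m :=
  exists f, [/\ K0 f, ord R (- m%:Z) f & forall R', R' != R -> ge R' 0 f].

(** The pole order is that of the leading monomial, so these orders form the semigroup generated by
    a and b, in the normal form with j < a. *)
Lemma pole_orderP e : pole_order P e <->
  exists i j, (j < a)%N /\ e = (a * i + b * j)%N.
Proof.
split=> [[f [K0f fP fR]]|[i [j [_ ->]]]].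
  have [M span] := monomial_span.
  pose n := (M + e)%N.
  have Lf : Lsp (<< P >> *+ (n * a)) f.
    apply/LspP; split=> //; apply: (pl_le AX _ (ord_pl_ge AX fP)).
    by rewrite lerN2 lez_nat /n; nia.
  have [|c fE] := span n _ f Lf; first exact: leq_addr.
  have [p [_ fP' _]] := monomial_min (ord_neq0 AX fP) fE.
  exists p.1, p.2; split=> //.
  by have := ord_inj AX fP fP'; lia.
exists (x ^+ i * y ^+ j); split; [exact: monomial_K0|exact: monomial_ord|].
by move=> R; apply: monomial_ge.
Qed.

(** Multiplication by x^(t + 1), whose divisor is (t + 1)(aQ - aP), trades the pole at Q for one at
    P and leaves a zero of order i at Q. *)
Lemma pole_order_Q t i : (0 < i < a)%N ->
  pole_order Q (t.+1 * a - i) <-> (b * i < t.+1 * a)%N.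
Proof.
move=> ia.
have QP : Q != P by rewrite eq_sym.
split=> [[f [K0f fQ fR]]|bi].
  apply: (@ord_Q_bound t.+1 i (f * x ^+ t.+1) ia).
    apply/LspP; split.
    - by apply: (pl_M AX) => //; apply: (K0X AX).
    - have := pl_geM AX (fR P PQ) (ord_pl_ge AX (ordX AX t.+1 xP)).
      by congr (ge P _ _); lia.
    - move=> R RP; have [->|RQ] := eqVneq R Q.
        apply: (pl_le AX _ (ord_pl_ge AX (pl_ordM AX fQ (ordX AX t.+1 xQ)))).
        by nia.
      rewrite -[0]addr0; apply: (pl_geM AX); first exact: fR.
      by apply/(geX AX)/xR_ge.
  have := pl_ordM AX fQ (ordX AX t.+1 xQ); congr (ord Q _ _); nia.
(* At Q the order is i - (t + 1)a; at P it is (t + 1)a - b i, positive by assumption. *)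
exists (y ^+ i * (x ^+ t.+1)^-1); split.
- by apply: (pl_M AX); [|apply: (pl_V AX)]; apply: (K0X AX).
- have := pl_ordM AX (ordX AX i ord_y) (pl_ordV AX (ordX AX t.+1 xQ)).
  by congr (ord Q _ _); nia.
- move=> R RQ; have [->|RP] := eqVneq R P.
    apply: (pl_le AX _ (ord_pl_ge AX (pl_ordM AX (ordX AX i yP)
      (pl_ordV AX (ordX AX t.+1 xP))))).
    by rewrite -!mulNrn; nia.
  rewrite -[0]addr0; apply: (pl_geM AX); first exact/(geX AX)/yR.
  have := ord_pl_ge AX (pl_ordV AX (ordX AX t.+1 (xR RP RQ))).
  by rewrite mul0rn oppr0.
Qed.

End TotallyRamifiedPoint.

(** * Non-gaps *)

Section SemigroupInterval.
Variables (a b t : nat).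
Local Open Scope nat_scope.

Let J := [pred j : 'I_a | (0 < j) && (b * j < t.+1 * a)].

(** [J] is an initial segment of the integers from 1 to a - 1, so i is at most its size exactly when
    i belongs to it. *)
Lemma card_interval_bound i : 0 < i < a ->
  (i <= #|J|) = (b * i < t.+1 * a).
Proof.
move=> /andP [i0 ia]; have [bi|bi] := ltnP.
  rewrite -(card_between ia); apply: subset_leq_card; apply/fintype.subsetP => j.
  rewrite inE => /andP [j0 ji]; rewrite inE j0 /=.
  by apply: leq_ltn_trans bi; rewrite leq_mul2l ji orbT.
apply/negbTE; rewrite -ltnNge.
have ia' : i.-1 < a by lia.
rewrite -[X in _ < X](prednK i0) ltnS -(card_between ia').
apply: subset_leq_card; apply/fintype.subsetP => j; rewrite inE => /andP [j0 bj]; rewrite inE j0 /=.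
by have := leq_trans bj bi; rewrite ltn_mul2l; lia.
Qed.

Hypothesis a_gt0 : 0 < a.

Lemma card_interval_lt : #|J| < a.
Proof.
have a1 : a.-1 < a by lia.
rewrite -[X in _ < X](prednK a_gt0) ltnS -(card_between a1).
apply: subset_leq_card; apply/fintype.subsetP => j; rewrite inE => /andP [j0 _]; rewrite inE j0 /=.
by have := ltn_ord j; lia.
Qed.

Lemma class_rep_lt (j : 'I_a) : t * a + (b * j) %% a < (t + 1) * a.
Proof. by have := ltn_pmod (b * j) a_gt0; lia. Qed.

(** The representative of the class of b j modulo a in the interval from ta to (t + 1)a - 1. *)
Let phi j := Ordinal (class_rep_lt j).

Hypothesis ab : coprime a b.

Lemma phi_inj : injective phi.
Proof.
move=> j j' [] /addnI E; apply: val_inj => /=.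
wlog jj : j j' E / j <= j'.
  move=> H; have [jj|/ltnW jj] := leqP j j'; first exact: H.
  exact/esym/H.
apply/eqP/negPn/negP => ne.
have /negP [] : ~~ (a %| b * (j' - j)).
  by apply: ndvd_mul => //; have := ltn_ord j'; lia.
by rewrite mulnBr -eqn_mod_dvd ?leq_mul2l ?jj ?orbT // E.
Qed.

Variable S : set nat.
Hypothesis SE : forall e, S e <-> exists i j, j < a /\ e = a * i + b * j.

(* In each nonzero residue class [b * j] modulo [a] the interval contains one
   integer, and it lies in the semigroup iff it is at least [b * j]. *)
Lemma card_interval :
  #|[pred e : 'I_((t + 1) * a) | (t * a < e) && ((e : nat) \in S)]| = #|J|.
Proof.
rewrite -(card_imset _ phi_inj); apply: eq_card => e; rewrite !inE.
apply/idP/imsetP => [/andP [te]|[j]].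
  rewrite in_setE => /SE [i [j [ja eE]]].
  have e_lt := ltn_ord e.
  exists (Ordinal ja).
    rewrite inE /=; apply/andP; split.
      2: by rewrite -(addn1 t); apply: leq_ltn_trans e_lt; rewrite eE leq_addl.
    rewrite lt0n; apply/eqP => /= j0; move: te e_lt.
    by rewrite eE j0 muln0 addn0 ![(a * i)%N]mulnC !ltn_pmul2r //; lia.
  apply: val_inj => /=.
  rewrite {1}(divn_eq e a); congr (_ * _ + _).
    by apply/eqP; rewrite eqn_leq -ltnS ltn_divLR // leq_divRL // -(addn1 t) e_lt ltnW.
  by rewrite eE mulnC modnMDl.
rewrite inE => /andP [j0 bj] ->; apply/andP; split => /=.
  rewrite -[X in X < _]addn0 ltn_add2l lt0n.
  by apply: (@ndvd_mul a b ab); rewrite j0 /=.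
(* Subtracting b j from ta + (b j mod a) leaves a multiple of a, with quotient t minus the integer
   part of b j / a. *)
rewrite in_setE; apply/SE; exists (t - (b * j) %/ a), j; split=> //.
have bjt : (b * j) %/ a <= t by rewrite -ltnS ltn_divLR.
by have := divn_eq (b * j) a; rewrite mulnBr; nia.
Qed.

End SemigroupInterval.

(** * Non-gaps as pole orders, and the theorem for abstract places *)

Section NonGaps.
Variables (k K : fieldType) (sc : {rmorphism k -> K}) (T : choiceType).
Variables (K0 : K -> Prop) (ge ord : T -> int -> K -> Prop).
Hypothesis AX : places sc K0 ge ord.
Local Notation Lsp := (Lsp K0 ge).

Definition abs_lin_equiv (D E : {freeg T}) : Prop :=
  exists f, [/\ K0 f, f != 0 & forall P, ord P (coeff P D - coeff P E) f].

Definition abs_nongaps (P : T) : set nat := [set m | m = 0%N \/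
  forall R, exists2 E, fgle 0 E /\ abs_lin_equiv E (<< P >> *+ m) & coeff R E = 0].

Definition abs_genus (g : nat) : Prop :=
  (forall D m, has_dim sc (Lsp D) m -> deg D + 1 - m%:Z <= g%:Z) /\
  (exists D m, has_dim sc (Lsp D) m /\ deg D + 1 - m%:Z = g%:Z).

Variable g : nat.
Hypothesis hg : abs_genus g.

(** A divisor of |mP| avoiding P gives a function with pole order exactly m at P. Conversely mP
    itself avoids every other point, and mP + div f avoids P. The constant 1 accounts for m = 0. *)
Lemma abs_nongapsP P m : abs_nongaps P m <-> pole_order K0 ge ord P m.
Proof.
have [genus_ub [D0 [m0 [D0_dim D0_genus]]]] := hg.
have one_ok : pole_order K0 ge ord P 0.
  exists 1; split; first exact: (K0_1 AX).
    by rewrite -(rmorph1 sc); apply: (pl_ord_sc AX); apply: oner_neq0.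
  by move=> R _; rewrite -(rmorph1 sc); apply: (pl_ge_sc AX).
split=> [[->//|/(_ P) [E [E0 [f [K0f f0 fE]]] EP]]|[f [K0f fP fR]]].
  exists f; split=> // [|R RP].
    by have := fE P; rewrite EP coeffMn coeff_pt eqxx; congr (ord P _ f); lia.
  have := fE R; rewrite coeffMn coeff_pt eq_sym (negPf RP) mul0rn subr0.
  move=> /(ord_pl_ge AX); apply: (pl_le AX).
  by move/fgposP: E0; apply.
right=> R; have [->|RP] := eqVneq R P; last first.
  exists (<< P >> *+ m); last by rewrite coeffMn coeff_pt eq_sym (negPf RP) mul0rn.
  split; first by apply/fgposP => S; rewrite coeffMn coeff_pt mulrn_wge0.
  exists 1; split; [exact: (K0_1 AX)|exact: oner_neq0|] => S.
  by rewrite subrr -(rmorph1 sc); apply: (pl_ord_sc AX); apply: oner_neq0.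
have f0 := ord_neq0 AX fP.
have Lf : Lsp (<< P >> *+ m) f.
  by apply/LspP; split=> //; apply: (ord_pl_ge AX).
have [E [E0 EP _]] := principal_divisor AX genus_ub D0_dim Lf f0.
exists E; first by split; [apply/fgposP|exists f].
have := ord_inj AX (EP P) fP; rewrite coeffMn coeff_pt eqxx.
by rewrite natz -[X in _ = X]add0r => /addIr.
Qed.

Theorem abs_nongaps_interval (P Q : T) (a b t s : nat) :
  [/\ abs_nongaps P a & (0 < a)%N] ->
  [/\ abs_nongaps P b & ~~ (a %| b)%N] ->
  coprime a b -> (2 * g = (a - 1) * (b - 1))%N -> Q != P ->
  abs_lin_equiv (<< Q >> *+ a) (<< P >> *+ a) ->
  s = #|[pred e : 'I_((t + 1) * a) |
                 (t * a < e)%N && ((e : nat) \in abs_nongaps P)]| ->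
  [set e | abs_nongaps Q e /\ (t * a < e < (t + 1) * a)%N] =
  [set ((t + 1) * a - i)%N | i in [set i | (1 <= i <= s)%N]].
Proof.
move=> [_ a_gt0] [/abs_nongapsP [y0 [K0y0 y0P y0R]] ndvd] ab gE QP [x [K0x x0 xE]].
have [genus_ub [D0 [m0 [D0_dim D0_genus]]]] := hg.
have PQ : P != Q by rewrite eq_sym.
have a_gt1 : (1 < a)%N 
  by rewrite ltn_neqAle a_gt0 andbT; apply: contraNneq ndvd => <-; apply: dvd1n.
have b_gt0 : (0 < b)%N by rewrite lt0n; apply: contraNneq ndvd => ->.
have xP : ord P (- a%:Z) x.
  have := xE P; rewrite !coeffMn !coeff_pt eqxx (negPf QP); congr (ord P _ x); lia.
have xQ : ord Q a%:Z x.
  have := xE Q; rewrite !coeffMn !coeff_pt eqxx (negPf PQ); congr (ord Q _ x); lia.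
have xR R : R != P -> R != Q -> ord R 0 x.
  rewrite eq_sym => /negPf PR; rewrite eq_sym => /negPf QR.
  by have := xE R; rewrite !coeffMn !coeff_pt PR QR; congr (ord R _ x); lia.
(* Subtracting the value at Q makes the function vanish there, and a constant does not affect the
   pole at P. *)
have [c yQ] : exists c, ge Q 1 (y0 - sc c * 1).
  apply: (pl_residue AX (y0R Q QP)).
  by rewrite -(rmorph1 sc); apply: (pl_ord_sc AX); apply: oner_neq0.
rewrite mulr1 -rmorphN in yQ.
pose y := y0 + sc (- c).
have K0y : K0 y by apply: (pl_D AX) => //; apply: (pl_sc AX).
have yP : ord P (- b%:Z) y.
  apply: (ord_addl AX) => //; apply: (pl_le AX _ (pl_ge_sc AX P (- c))).
  by lia.
have yR R : R != P -> ge R 0 y.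
  by move=> RP; apply: (pl_geD AX); [apply: y0R|apply: (pl_ge_sc AX)].
have SE e : abs_nongaps P e <-> exists i j, (j < a)%N /\ e = (a * i + b * j)%N.
  rewrite abs_nongapsP.
  exact: (pole_orderP AX genus_ub D0_dim D0_genus PQ a_gt1 b_gt0 ab gE
            K0x xP xQ xR K0y yP yR).
have QE i : (0 < i < a)%N ->
    pole_order K0 ge ord Q (t.+1 * a - i) <-> (b * i < t.+1 * a)%N.
  exact: (pole_order_Q AX genus_ub D0_dim D0_genus PQ a_gt1 b_gt0 ab gE
            K0x xP xQ xR K0y yP yR yQ).
rewrite (card_interval t a_gt0 ab SE) => ->.
have s_lt := card_interval_lt b t a_gt0.
have sE := @card_interval_bound a b t.
set s' := #|_| in s_lt sE *.
apply/seteqP; split=> [e [/abs_nongapsP eQ /andP [te et]]|_ [i /andP [i1 is'] <-]].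
  have eE : e = (t.+1 * a - (t.+1 * a - e))%N by lia.
  have i_lt : (0 < t.+1 * a - e < a)%N by lia.
  exists (t.+1 * a - e)%N; last by rewrite addn1.
  apply/andP; split; first by lia.
  by rewrite sE //; apply/(QE _ i_lt); rewrite -eE.
have i_lt : (0 < i < a)%N by lia.
split; last by lia.
by apply/abs_nongapsP; rewrite addn1; apply/(QE _ i_lt); rewrite -sE.
Qed.

End NonGaps.

(** * Return to the concrete curve *)

Section CurveBridge.
Variables (k : closedFieldType) (N : nat) (C : smooth_curve k N).
Local Notation K := (hfrac C : fieldType).
Hypothesis has_unif : forall P : C, exists t : K, uniformizer P t.

Let sc : {rmorphism k -> K} := @hom_scalar _ _ _ (hcls C).
Let AX := curve_places has_unif.

(** The two forms agree because every nonzero function has an order at each point. *)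
Lemma rr_spaceE (D : {freeg C}) :
  rr_space D = Lsp (@function_field k N C : K -> Prop) (pge has_unif) D.
Proof.
apply/seteqP; split=> f [K0f].
  move=> [f0|fD]; split=> // P; first by rewrite f0; apply: (pl_ge0 AX).
  have [z fz zD] := fD P; apply: (pl_le AX zD).
  exact: (ord_pl_ge AX (P := P) (z := z) (f := f) fz).
move=> fD; split=> //; have [f0|f0] := pselect (f = 0); first by left.
right=> P; have f0' : (f : K) != 0 by apply/eqP.
have [z fz] := pl_exists AX P K0f f0'.
by exists z => //; apply: (ord_ge_le AX fz (fD P)).
Qed.

Lemma genusE g : genus C g ->
  abs_genus sc (@function_field k N C : K -> Prop) (pge has_unif) g.
Proof.
move=> [ub [D [m [Dm Dg]]]]; split=> [D' m' D'm'|].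
  by apply: ub; rewrite rr_spaceE; exact: D'm'.
by exists D, m; split=> //; rewrite -rr_spaceE; exact: Dm.
Qed.

End CurveBridge.
Unset Implicit Arguments.
Set Strict Implicit.
Set Printing Implicit Defensive.

Theorem theorem2 (R : realType) (N : nat) (C : smooth_curve R[i] N) (g : nat)
    (P Q : C) (a b n r t s : nat)
    (hg : genus C g)
    (ha : [/\ nongaps P a, (0 < a)%N &
           forall m, nongaps P m -> (0 < m)%N -> (a <= m)%N])
    (hb : [/\ nongaps P b, ~~ (a %| b)%N &
           forall m, nongaps P m -> ~~ (a %| m)%N -> (b <= m)%N])
    (hbnr : b = (n * a + r)%N) (hn : (1 <= n)%N) (hr : (0 < r < a)%N)
    (hab : gcdn a b = 1%N)
    (hgab : (2 * g = (a - 1) * (b - 1))%N)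
    (hPQ : Q <> P)
    (haQ : linear_system (<< P >> *+ a) (<< Q >> *+ a))
    (ht : (1 <= t)%N)
    (hs : s = #|[pred e : 'I_((t + 1) * a) |
                 (t * a < e)%N && ((e : nat) \in nongaps P)]|) :
  [set e | nongaps Q e /\ (t * a < e < (t + 1) * a)%N] =
  [set ((t + 1) * a - i)%N | i in [set i | (1 <= i <= s)%N]].
Proof.
(* The equivalence of aQ and aP provides a function with an order at every point, and [has_ord]
   comes with a uniformizer there. *)
have unif (P' : C) : exists t' : (hfrac C : fieldType), uniformizer P' t'.
  by have [_ [f [_ _ /(_ P') [t' [u [ut' _ _ _]]]]]] := haQ; exists t'.
have QP : Q != P by apply/eqP.
have [aP a_gt0 _] := ha; have [bP b_ndvd _] := hb.
have [_ xE] := haQ.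
exact: (abs_nongaps_interval (curve_places unif) (genusE unif hg)
  (conj aP a_gt0) (conj bP b_ndvd) (introT eqP hab) hgab QP xE hs).
Qed.
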